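(* Let $\Omega\subset\mathbb{R}^n$ be a bounded domain of class $C^2$ and let $0<a\le A$. For $\alpha>0$ let $\lambda_\alpha^+$ and $\lambda_\alpha^-$ be the principal eigenvalues of the Pucci operator $\mathcal{M}_{a,A}^+$ in $\Omega$ with boundary condition $\frac{\partial u}{\partial\overrightarrow{n}}=\alpha u$ on $\partial\Omega$, as defined in the context. Then $$\lim_{\alpha\to+\infty}\frac{\lambda_\alpha^+}{-\alpha^2}=A\qquad\text{and}\qquad \lim_{\alpha\to+\infty}\frac{\lambda_\alpha^-}{-\alpha^2}=a.$$
   Context: $S(n)$ is the space of real symmetric $n\times n$ matrices with the usual ordering. For $M\in S(n)$, $\mathcal{M}_{a,A}^+(M)=\sup\{\mathrm{tr}(\sigma M): \sigma\in S(n),\ aI\le\sigma\le AI\}$. $\overrightarrow{n}(x)$ is the exterior unit normal to $\partial\Omega$ at $x$. Viscosity sub/supersolutions. Let $\alpha>0$, $\lambda\in\mathbb{R}$. A function $u\in USC(\overline\Omega)$ (upper semicontinuous) is a viscosity subsolution of $\mathcal{M}_{a,A}^+(D^2u)+\lambda u=0$ in $\Omega$, $\frac{\partial u}{\partial\overrightarrow{n}}=\alpha u$ on $\partial\Omega$, if whenever $\varphi\in C^2(\overline\Omega)$ and $u-\varphi$ has a local maximum (relative to $\overline\Omega$) at $x_0\in\overline\Omega$: (i) if $x_0\in\Omega$, then $\mathcal{M}_{a,A}^+(D^2\varphi(x_0))+\lambda u(x_0)\ge 0$; (ii) if $x_0\in\partial\Omega$, then $\min\{-(\mathcal{M}_{a,A}^+(D^2\varphi(x_0))+\lambda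 u(x_0)),\ \frac{\partial\varphi}{\partial\overrightarrow{n}}(x_0)-\alpha u(x_0)\}\le 0$. A function $u\in LSC(\overline\Omega)$ (lower semicontinuous) is a viscosity supersolution if whenever $\varphi\in C^2(\overline\Omega)$ and $u-\varphi$ has a local minimum at $x_0$: (i) if $x_0\in\Omega$, then $\mathcal{M}_{a,A}^+(D^2\varphi(x_0))+\lambda u(x_0)\le 0$; (ii) if $x_0\in\partial\Omega$, then $\max\{-(\mathcal{M}_{a,A}^+(D^2\varphi(x_0))+\lambda u(x_0)),\ \frac{\partial\varphi}{\partial\overrightarrow{n}}(x_0)-\alpha u(x_0)\}\ge 0$. Principal eigenvalues: $\lambda_\alpha^+:=\sup\{\lambda\in\mathbb{R}:$ there exists $v>0$ on $\overline\Omega$, bounded viscosity supersolution of $\mathcal{M}_{a,A}^+(D^2v)+\lambda v=0$ in $\Omega$, $\frac{\partial v}{\partial\overrightarrow{n}}=\alpha v$ on $\partial\Omega\}$; $\lambda_\alpha^-:=\sup\{\lambda\in\mathbb{R}:$ there exists $v<0$ on $\overline\Omega$, bounded viscosity subsolution of $\mathcal{M}_{a,A}^+(D^2v)+\lambda v=0$ in $\Omega$, $\frac{\partial v}{\partial\overrightarrow{n}}=\alpha v$ on $\partial\Omega\}$. *)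

(* Defs.v *)
From HB Require Import structures.
From mathcomp Require Import all_boot all_order all_algebra.
From mathcomp Require Import all_classical all_reals all_analysis.

Set Implicit Arguments.
Unset Strict Implicit.
Unset Printing Implicit Defensive.

Import Order.TTheory GRing.Theory Num.Theory.
Import numFieldNormedType.Exports.

Local Open Scope classical_set_scope.
Local Open Scope ring_scope.

(* Points of R^n are row vectors.  The library norm on 'rV[R]_n is the sup norm:
   it gives the usual topology, differentials and bounded sets, but unit vectors
   must be normalised with the Euclidean norm [enorm]. *)

Definition dotp (R : realType) (n : nat) (x y : 'rV[R]_n) : R :=
  (x *m y^T) ord0 ord0.

Definition enorm (R : realType) (n : nat) (x : 'rV[R]_n) : R :=
  Num.sqrt (dotp x x).

Definition grad (R : realType) (n : nat) (f : 'rV[R]_n -> R) (x : 'rV[R]_n)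
  : 'rV[R]_n := \row_i 'D_(delta_mx ord0 i) f x.

Definition hessian (R : realType) (n : nat) (f : 'rV[R]_n -> R) (x : 'rV[R]_n)
  : 'M[R]_n := 'J (grad f) x.

Definition C2_on (R : realType) (n : nat) (U : set 'rV[R]_n)
    (f : 'rV[R]_n -> R) : Prop :=
  forall x, U x -> [/\ differentiable f x, differentiable (grad f) x
                    & {for x, continuous (hessian f)}].

(* f belongs to C^2 of the closure of the open set O: f is C^2 in O, and f, its
   gradient and its Hessian extend continuously to the closure.  G and H are
   these extensions; they are determined on the closure by f, and their values
   at a boundary point are what Df and D^2f mean there. *)
Definition C2_closure (R : realType) (n : nat) (O : set 'rV[R]_n)
    (f : 'rV[R]_n -> R) (G : 'rV[R]_n -> 'rV[R]_n) (H : 'rV[R]_n -> 'M[R]_n)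
    : Prop :=
  [/\ C2_on O f,
      (forall x, O x -> G x = grad f x /\ H x = hessian f x),
      {within closure O, continuous f},
      {within closure O, continuous G}
    & {within closure O, continuous H}].

Definition boundary (R : realType) (n : nat) (O : set 'rV[R]_n)
  : set 'rV[R]_n := closure O `\` O°.

Definition local_defining_function (R : realType) (n : nat)
    (O : set 'rV[R]_n) (x : 'rV[R]_n) (U : set 'rV[R]_n)
    (rho : 'rV[R]_n -> R) : Prop :=
  [/\ open_nbhs x U,
      C2_on U rho,
      (forall y, U y -> grad rho y != 0),
      O `&` U = [set y | rho y < 0] `&` U
    & boundary O `&` U = [set y | rho y = 0] `&` U].

Definition bounded_C2_domain (R : realType) (n : nat) (O : set 'rV[R]_n)
    : Prop :=
  [/\ O !=set0, open O, connected O, bounded_set O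
    & forall x, boundary O x ->
        exists U rho, local_defining_function O x U rho].

(* At a boundary point of a C^2 domain, the gradients of two local defining
   functions are positive multiples of each other, so exactly one vector
   satisfies the description below. *)
Definition outer_normal (R : realType) (n : nat) (O : set 'rV[R]_n)
    (x : 'rV[R]_n) : 'rV[R]_n :=
  xget 0 [set nu | exists U rho, local_defining_function O x U rho /\
                     nu = (enorm (grad rho x))^-1 *: grad rho x].

Definition lemx (R : realType) (n : nat) (M N : 'M[R]_n) : Prop :=
  forall x : 'rV[R]_n, dotp (x *m M) x <= dotp (x *m N) x.

Definition pucci (R : realType) (n : nat) (a A : R) (M : 'M[R]_n) : R :=
  sup [set \tr (sigma *m M) | sigma in
        [set sigma : 'M[R]_n |
          [/\ sigma^T = sigma, lemx a%:M sigma & lemx sigma A%:M]]].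

Definition lsc_on (R : realType) (n : nat) (D : set 'rV[R]_n)
    (u : 'rV[R]_n -> R) : Prop :=
  @lower_semicontinuous (subspace D) R (EFin \o u).

Definition usc_on (R : realType) (n : nat) (D : set 'rV[R]_n)
    (u : 'rV[R]_n -> R) : Prop :=
  lsc_on D (fun x => - u x).

Definition local_max_on (R : realType) (n : nat) (D : set 'rV[R]_n)
    (w : 'rV[R]_n -> R) (x0 : 'rV[R]_n) : Prop :=
  \forall y \near within D (nbhs x0), w y <= w x0.

Definition local_min_on (R : realType) (n : nat) (D : set 'rV[R]_n)
    (w : 'rV[R]_n -> R) (x0 : 'rV[R]_n) : Prop :=
  \forall y \near within D (nbhs x0), w x0 <= w y.

(* Only the values of u on the closure of O matter in the next two definitions. *)
Definition viscosity_subsolution (R : realType) (n : nat) (a A : R)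
    (O : set 'rV[R]_n) (alpha lambda : R) (u : 'rV[R]_n -> R) : Prop :=
  usc_on (closure O) u /\
  forall phi Dphi D2phi, C2_closure O phi Dphi D2phi ->
  forall x0, closure O x0 ->
    local_max_on (closure O) (fun y => u y - phi y) x0 ->
    (O x0 -> 0 <= pucci a A (D2phi x0) + lambda * u x0) /\
    (boundary O x0 ->
      Num.min (- (pucci a A (D2phi x0) + lambda * u x0))
              (dotp (Dphi x0) (outer_normal O x0) - alpha * u x0) <= 0).

Definition viscosity_supersolution (R : realType) (n : nat) (a A : R)
    (O : set 'rV[R]_n) (alpha lambda : R) (u : 'rV[R]_n -> R) : Prop :=
  lsc_on (closure O) u /\
  forall phi Dphi D2phi, C2_closure O phi Dphi D2phi ->
  forall x0, closure O x0 ->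
    local_min_on (closure O) (fun y => u y - phi y) x0 ->
    (O x0 -> pucci a A (D2phi x0) + lambda * u x0 <= 0) /\
    (boundary O x0 ->
      0 <= Num.max (- (pucci a A (D2phi x0) + lambda * u x0))
                   (dotp (Dphi x0) (outer_normal O x0) - alpha * u x0)).

(* The suprema are taken in the extended reals; their finiteness is not built
   into the definition. *)
Definition lambda_plus (R : realType) (n : nat) (a A : R)
    (O : set 'rV[R]_n) (alpha : R) : \bar R :=
  ereal_sup [set lambda%:E | lambda in [set lambda : R |
    exists v : 'rV[R]_n -> R,
      [/\ forall x, closure O x -> 0 < v x,
          [bounded v x | x in closure O]
        & viscosity_supersolution a A O alpha lambda v]]].

Definition lambda_minus (R : realType) (n : nat) (a A : R)
    (O : set 'rV[R]_n) (alpha : R) : \bar R :=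
  ereal_sup [set lambda%:E | lambda in [set lambda : R |
    exists v : 'rV[R]_n -> R,
      [/\ forall x, closure O x -> v x < 0,
          [bounded v x | x in closure O]
        & viscosity_subsolution a A O alpha lambda v]]].

(* Main.v *)
(* Upper bounds.  For [0 < b < alpha] the positive function
   [u x = exp (b x_i)] satisfies [du/dn <= b u < alpha u] on the boundary and
   has Hessian [b^2 u e_i e_i^T], so the largest multiple of [u] below a
   positive supersolution touches it at a point where [lambda <= - A b^2]; for
   negative subsolutions the same argument gives [lambda <= - a b^2].  Let [b]
   tend to [alpha].

   Lower bounds.  A bounded C^2 domain satisfies, for some [r > 0], a uniform
   interior ball condition: every point of the closure is within [r] of the set
   [K] of centers of balls of radius [r] contained in the domain.  The function
   [w = exp (alpha dist(x, K)^2 / (2 r))] is an infimum of smooth functions with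
   logarithmic gradient at most [alpha], its normal derivative on the boundary
   is [alpha w], and testing it against the Pucci operator shows that [w] and
   [- w] are admissible for [- A (alpha^2 + n alpha / r)] and
   [- a (alpha^2 + n alpha / r)] respectively. *)
Require Import Defs.
From HB Require Import structures.
From mathcomp Require Import all_boot all_order all_algebra.
From mathcomp Require Import all_classical all_reals all_analysis.
From mathcomp Require Import ring lra.

Set Implicit Arguments.
Unset Strict Implicit.
Unset Printing Implicit Defensive.

Import Order.TTheory GRing.Theory Num.Theory.
Import numFieldNormedType.Exports.

Local Open Scope classical_set_scope.
Local Open Scope ring_scope.

(** * The Euclidean inner product on row vectors *)

Section dotp.
Context {R : realType} {n : nat}.
Implicit Types (q x y z : 'rV[R]_n) (k : R) (M : 'M[R]_n).

Lemma dotpE x y : dotp x y = \sum_i x 0 i * y 0 i.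
Proof. by rewrite /dotp mxE; apply: eq_bigr => i _; rewrite mxE. Qed.

Lemma dotpC x y : dotp x y = dotp y x.
Proof. by rewrite !dotpE; apply: eq_bigr => i _; rewrite mulrC. Qed.

Lemma dotpDl x y z : dotp (x + y) z = dotp x z + dotp y z.
Proof. by rewrite /dotp mulmxDl mxE. Qed.

Lemma dotpZl k x z : dotp (k *: x) z = k * dotp x z.
Proof. by rewrite /dotp -scalemxAl mxE. Qed.

Lemma dotpNl x z : dotp (- x) z = - dotp x z.
Proof. by rewrite -scaleN1r dotpZl mulN1r. Qed.

Lemma dotpBl x y z : dotp (x - y) z = dotp x z - dotp y z.
Proof. by rewrite dotpDl dotpNl. Qed.

Lemma dotpDr x y z : dotp z (x + y) = dotp z x + dotp z y.
Proof. by rewrite dotpC dotpDl !(dotpC z). Qed.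

Lemma dotpZr k x z : dotp z (k *: x) = k * dotp z x.
Proof. by rewrite dotpC dotpZl (dotpC z). Qed.

Lemma dotpNr x z : dotp z (- x) = - dotp z x.
Proof. by rewrite dotpC dotpNl (dotpC z). Qed.

Lemma dotpBr x y z : dotp z (x - y) = dotp z x - dotp z y.
Proof. by rewrite dotpDr dotpNr. Qed.

Lemma dotp0l z : dotp 0 z = 0.
Proof. by rewrite -(scale0r z) dotpZl mul0r. Qed.

Lemma dotp_ge0 x : 0 <= dotp x x.
Proof. by rewrite dotpE sumr_ge0// => i _; rewrite -expr2 sqr_ge0. Qed.

Lemma dotp_eq0 x : dotp x x = 0 -> x = 0.
Proof.
rewrite dotpE => /eqP; rewrite psumr_eq0; last first.
  by move=> i _; rewrite -expr2 sqr_ge0.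
move=> /allP x0; apply/rowP => i; rewrite mxE.
by have := x0 i; rewrite mem_index_enum mulf_eq0 orbb => /(_ isT)/eqP.
Qed.

Lemma enorm_sqr x : enorm x ^+ 2 = dotp x x.
Proof. by rewrite sqr_sqrtr// dotp_ge0. Qed.

Lemma enorm_ge0 x : 0 <= enorm x. Proof. exact: sqrtr_ge0. Qed.

Lemma enorm_gt0 x : x != 0 -> 0 < enorm x.
Proof.
move=> x0; rewrite sqrtr_gt0 lt_neqAle dotp_ge0 andbT eq_sym.
by apply: contra x0 => /eqP/dotp_eq0 ->.
Qed.

(** The sup norm is the absolute value of one coordinate, whose square is one term of the sum. This
    turns Euclidean bounds into bounds for the library norm, which governs neighbourhoods. *)
Lemma sqr_norm_le_dotp x : `|x| ^+ 2 <= dotp x x.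
Proof.
have [->|x0] := eqVneq `|x| 0; first by rewrite expr0n/= dotp_ge0.
have [[i j] /= xij] := mx_norm_neq0 x0.
rewrite [X in X ^+ 2](_ : `|x| = `|x i j|)// -normrX ger0_norm ?sqr_ge0//.
rewrite ord1 dotpE (bigD1 j)//= -expr2 lerDl sumr_ge0// => k _.
by rewrite -expr2 sqr_ge0.
Qed.

Lemma norm_coord_le x i : `|x 0 i| <= `|x|.
Proof.
rewrite [leRHS]mx_normrE; apply/bigmax_geP; right => /=.
by exists (0, i).
Qed.

Lemma dotp_le_norm x y : `|dotp x y| <= n%:R * `|x| * `|y|.
Proof.
rewrite dotpE (le_trans (ler_norm_sum _ _ _))//.
apply: (@le_trans _ _ (\sum_(i < n) `|x| * `|y|)).
  by apply: ler_sum => i _; rewrite normrM ler_pM// norm_coord_le.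
by rewrite sumr_const card_ord -mulrA mulr_natl.
Qed.

Lemma cauchy_schwarz x y : dotp x y ^+ 2 <= dotp x x * dotp y y.
Proof.
have [y0|/eqP y0] := pselect (dotp y y = 0).
  by rewrite (dotp_eq0 y0) dotpC !dotp0l expr0n mulr0.
have := dotp_ge0 (dotp y y *: x - dotp x y *: y).
rewrite !(dotpBl, dotpBr, dotpZl, dotpZr) (dotpC y x).
have := dotp_ge0 y; move: y0; move: (dotp x x) (dotp y y) (dotp x y) => p q r.
move=> q0 qge0.
have qgt0 : 0 < q by rewrite lt_neqAle eq_sym q0.
rewrite (_ : _ - _ = q * (p * q - r ^+ 2)); last by ring.
by rewrite pmulr_rge0// subr_ge0.
Qed.

Lemma dotp_delta i : dotp (delta_mx 0 i : 'rV[R]_n) (delta_mx 0 i) = 1.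
Proof.
rewrite dotpE (bigD1 i)//= !mxE !eqxx mulr1 big1 ?addr0// => j /negPf ji.
by rewrite !mxE ji mul0r.
Qed.

Lemma dotp_delta_r x i : dotp x (delta_mx 0 i) = x 0 i.
Proof.
rewrite dotpE (bigD1 i)//= !mxE !eqxx mulr1 big1 ?addr0// => j /negPf ji.
by rewrite !mxE ji mulr0.
Qed.

Lemma delta_form M i j :
  dotp (delta_mx 0 i *m M) (delta_mx 0 j) = M i j.
Proof. by rewrite -rowE dotp_delta_r mxE. Qed.

Lemma dotp_scalar k x : dotp (x *m k%:M) x = k * dotp x x.
Proof. by rewrite mul_mx_scalar dotpZl. Qed.

Lemma rank_one_form q x : dotp (x *m (q^T *m q)) x = dotp q x ^+ 2.
Proof.
rewrite mulmxA [x *m q^T]mx11_scalar mul_scalar_mx dotpZl -/(dotp x q).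
by rewrite (dotpC x) expr2.
Qed.

End dotp.

(** * Traces and the Pucci operator *)

Section trace.
Context {R : realType} {n : nat}.
Implicit Types (M N sigma : 'M[R]_n) (v x y : 'rV[R]_n).

Definition psd sigma := sigma^T = sigma /\ forall x, 0 <= dotp (x *m sigma) x.

Lemma form_sym sigma x y : sigma^T = sigma ->
  dotp (x *m sigma) y = dotp (y *m sigma) x.
Proof.
move=> sT; rewrite /dotp -[in LHS](trmxK (x *m sigma *m y^T)) [LHS]mxE.
by rewrite !trmx_mul trmxK sT mulmxA.
Qed.

(** The value of the form at [x + t y] is a quadratic polynomial in [t] that is never negative, so
    its discriminant is not positive. *)
Lemma psd_cauchy_schwarz sigma x y : psd sigma ->
  dotp (x *m sigma) y ^+ 2 <= dotp (x *m sigma) x * dotp (y *m sigma) y.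
Proof.
move=> [sT s0].
have q (t : R) : 0 <= dotp (x *m sigma) x
    + 2 * t * dotp (x *m sigma) y + t ^+ 2 * dotp (y *m sigma) y.
  have := s0 (x + t *: y).
  rewrite mulmxDl -scalemxAl !(dotpDl, dotpDr, dotpZl, dotpZr).
  rewrite (form_sym y x sT) => h; apply: le_trans h _.
  by rewrite le_eqVlt; apply/orP; left; apply/eqP; ring.
have := s0 x; have := s0 y; move: q.
move: (dotp (x *m sigma) y) (dotp (x *m sigma) x) (dotp (y *m sigma) y).
clear=> p r s q s_ge0 r_ge0.
have [s_eq0|/eqP s_neq0] := pselect (s = 0).
  have [->|p0] := eqVneq p 0; first by rewrite expr0n mulr_ge0.
  (* Without a quadratic term the polynomial is affine in [t]; here it equals [- r - 2], which is
     negative. *)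
  have := q (- (r + 1) / p).
  rewrite s_eq0 mulr0 addr0 (_ : _ * p = - 2 * (r + 1)); last by field.
  by move=> ?; exfalso; lra.
have s_gt0 : 0 < s by rewrite lt_neqAle eq_sym s_neq0.
(* The minimiser of the polynomial. *)
have := q (- p / s).
rewrite (_ : _ + _ = (r * s - p ^+ 2) / s); last by field.
by rewrite pmulr_lge0 ?invr_gt0// subr_ge0.
Qed.

(* A Cholesky step: subtracting [v^T v], with [v] the normalised row [i] of
   [sigma], kills row and column [i] while preserving positivity. *)
Lemma psd_sum_of_squares sigma : psd sigma ->
  exists s : seq 'rV[R]_n, sigma = \sum_(v <- s) v^T *m v.
Proof.
have [k] := ubnP #|[set i | sigma i i != 0]%SET|.
elim: k sigma => // k IHk sigma cardk sp.
have [/existsP[i si]|s0] := boolP [exists i, sigma i i != 0]; last first.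
  exists [::]; rewrite big_nil; apply/matrixP => i j; rewrite mxE.
  have := psd_cauchy_schwarz (delta_mx 0 i) (delta_mx 0 j) sp.
  rewrite !delta_form; move: s0; rewrite negb_exists => /forallP/(_ i).
  rewrite negbK => /eqP ->; rewrite mul0r => sij.
  by apply/eqP; rewrite -sqrf_eq0 eq_le sij sqr_ge0.
have [sT s_ge0] := sp.
have si_gt0 : 0 < sigma i i.
  by rewrite lt_neqAle eq_sym si -(delta_form sigma i i) s_ge0.
pose v := (Num.sqrt (sigma i i))^-1 *: row i sigma.
have vE p q : (v^T *m v) p q = sigma i p * sigma i q / sigma i i.
  rewrite !mxE big_ord1 !mxE.
  rewrite mulrACA -invfM -expr2 sqr_sqrtr ?(ltW si_gt0)//.
  by rewrite mulrC.
have v_form x : dotp (x *m (v^T *m v)) x = dotp (x *m sigma) (delta_mx 0 i) ^+ 2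
                                            / sigma i i.
  rewrite rank_one_form (dotpC v x) /v dotpZr exprMn exprVn.
  rewrite sqr_sqrtr ?(ltW si_gt0)//.
  by rewrite rowE (dotpC x) (form_sym _ x sT) mulrC.
have sym' : (sigma - v^T *m v)^T = sigma - v^T *m v.
  by rewrite linearB /= sT trmx_mul trmxK.
have psd' : psd (sigma - v^T *m v).
  split=> // x; rewrite mulmxBr dotpBl v_form subr_ge0 ler_pdivrMr//.
  by rewrite -[X in _ * X](delta_form sigma i i) psd_cauchy_schwarz.
have /IHk[|s sE] := psd'; last first.
- by exists (v :: s); rewrite big_cons -sE addrC subrK.
- rewrite -ltnS; apply: leq_trans cardk; rewrite ltnS; apply: proper_card.
  apply/properP; split.
    apply/fintype.subsetP => j; rewrite !inE; apply: contra => /eqP sj0.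
    have sij : sigma i j = 0.
      apply/eqP; rewrite -sqrf_eq0 eq_le sqr_ge0 andbT.
      have := psd_cauchy_schwarz (delta_mx 0 i) (delta_mx 0 j) sp.
      by rewrite !delta_form sj0 mulr0.
    by rewrite mxE [X in _ + X]mxE vE sij sj0 mul0r mul0r subr0.
  exists i; rewrite !inE// negbK mxE [X in _ + X]mxE vE.
  by rewrite mulfK ?subrr.
Qed.

(** Once [sigma] is a sum of squares [v^T v], both traces are sums of the values of the two forms at
    the vectors [v]. *)
Lemma mxtrace_psd_le sigma M N : psd sigma -> lemx M N ->
  \tr (sigma *m M) <= \tr (sigma *m N).
Proof.
move=> /psd_sum_of_squares[s ->] MN.
rewrite !mulmx_suml !raddf_sum/=; apply: ler_sum => v _.
rewrite -!mulmxA ![\tr (v^T *m _)]mxtrace_mulC.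
by rewrite ![\tr _]big_ord1; exact: MN.
Qed.

End trace.

Section pucci.
Context {R : realType} {n : nat} (a A : R).
Hypotheses (a_gt0 : 0 < a) (aA : a <= A).
Implicit Types (M N sigma : 'M[R]_n).

Let admissible sigma := [/\ sigma^T = sigma, lemx a%:M sigma & lemx sigma A%:M].

Let A_ge0 : 0 <= A. Proof. exact: le_trans (ltW a_gt0) aA. Qed.

Lemma psd_scalar k : 0 <= k -> psd (k%:M : 'M[R]_n).
Proof.
move=> k0; split; first by rewrite tr_scalar_mx.
by move=> x; rewrite dotp_scalar mulr_ge0// dotp_ge0.
Qed.

Lemma admissible_psd sigma : admissible sigma -> psd sigma.
Proof.
move=> [sT as_ _]; split=> // x; apply: le_trans (as_ x).
by rewrite dotp_scalar mulr_ge0 ?dotp_ge0// ltW.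
Qed.

Lemma admissible_scalar k : a <= k <= A -> admissible k%:M.
Proof.
move=> /andP[ak kA]; split; first by rewrite tr_scalar_mx.
- by move=> x; rewrite !dotp_scalar ler_wpM2r// dotp_ge0.
- by move=> x; rewrite !dotp_scalar ler_wpM2r// dotp_ge0.
Qed.

(** Diagonal entries are values of the form at unit vectors, hence lie between 0 and [A];
    Cauchy-Schwarz controls the others. The bound makes the set of traces bounded above, so that
    [sup] is a genuine least upper bound. *)
Lemma admissible_entry sigma i j : admissible sigma -> `|sigma i j| <= A.
Proof.
move=> as_; have sp := admissible_psd as_.
have diag k : 0 <= sigma k k <= A.
  rewrite -!(delta_form sigma k k) (sp.2 _)/=; have [_ _ sA] := as_.
  by apply: le_trans (sA _) _; rewrite dotp_scalar dotp_delta mulr1.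
rewrite -ler_sqr ?nnegrE// real_normK ?num_real//.
have := psd_cauchy_schwarz (delta_mx 0 i) (delta_mx 0 j) sp.
rewrite !delta_form => /le_trans; apply.
have /andP[? ?] := diag i; have /andP[? ?] := diag j.
by rewrite expr2 ler_pM.
Qed.

Lemma pucci_ge sigma M : admissible sigma -> \tr (sigma *m M) <= pucci a A M.
Proof.
move=> as_; apply: ub_le_sup; last by exists sigma.
exists (\sum_i \sum_j A * `|M j i|) => _ [tau at_ <-].
apply: ler_sum => i _; rewrite mxE; apply: ler_sum => j _.
by rewrite (le_trans (ler_norm _))// normrM ler_wpM2r// admissible_entry.
Qed.

Lemma pucci_le M c :
  (forall sigma, admissible sigma -> \tr (sigma *m M) <= c) -> pucci a A M <= c.
Proof.
move=> Mc; apply: ge_sup; last by move=> _ [sigma as_ <-]; exact: Mc.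
by exists (\tr (a%:M *m M)), a%:M => //; apply: admissible_scalar; rewrite lexx.
Qed.

(** Against [N >= 0] the trace of [sigma N] is monotone in [sigma], so the extreme choice is [A I];
    against [- N], as in the next lemma, it is [a I]. This asymmetry is what separates the two
    limits. *)
Lemma pucci_le_psd M N : psd N -> lemx M N -> pucci a A M <= A * \tr N.
Proof.
move=> N0 MN; apply: pucci_le => sigma as_.
apply: (le_trans (mxtrace_psd_le (admissible_psd as_) MN)).
rewrite mxtrace_mulC -mxtraceZ -mul_mx_scalar.
by apply: mxtrace_psd_le => //; case: as_.
Qed.

Lemma pucci_le_nsd M N : psd N -> lemx M (- N) -> pucci a A M <= - (a * \tr N).
Proof.
move=> N0 MN; apply: pucci_le => sigma as_.
apply: (le_trans (mxtrace_psd_le (admissible_psd as_) MN)).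
rewrite mulmxN raddfN/= mxtrace_mulC lerN2 -mxtraceZ -mul_mx_scalar.
by apply: mxtrace_psd_le => //; case: as_.
Qed.

(** The matrix [k I] competes in the supremum. The choice [k = A] serves the upper bound for
    supersolutions, and [k = a] the barrier subsolution. *)
Lemma pucci_ge_scalar k M N : a <= k <= A -> lemx N M ->
  k * \tr N <= pucci a A M.
Proof.
move=> akA NM; have /andP[ak _] := akA.
apply: le_trans (pucci_ge M (admissible_scalar akA)).
rewrite -mxtraceZ -mul_scalar_mx; apply: mxtrace_psd_le => //.
by apply: psd_scalar; exact: le_trans (ltW a_gt0) ak.
Qed.

End pucci.

Section rank_one.
Context {R : realType} {n : nat}.

Lemma mxtrace_rank_one (q : 'rV[R]_n) : \tr (q^T *m q) = dotp q q.
Proof. by rewrite mxtrace_mulC [LHS]big_ord1. Qed.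

Lemma scalar_rank_one_form c d (q x : 'rV[R]_n) :
  dotp (x *m (c%:M + d *: (q^T *m q))) x = c * dotp x x + d * dotp q x ^+ 2.
Proof.
by rewrite mulmxDr dotpDl dotp_scalar -scalemxAr dotpZl rank_one_form.
Qed.

Lemma psd_scalar_rank_one c d (q : 'rV[R]_n) : 0 <= c -> 0 <= d ->
  psd (c%:M + d *: (q^T *m q)).
Proof.
move=> c0 d0; split.
  by rewrite linearD linearZ /= tr_scalar_mx trmx_mul trmxK.
move=> x; rewrite scalar_rank_one_form.
by apply: addr_ge0; rewrite mulr_ge0// ?dotp_ge0// sqr_ge0.
Qed.

Lemma mxtrace_scalar_rank_one c d (q : 'rV[R]_n) :
  \tr (c%:M + d *: (q^T *m q)) = c * n%:R + d * dotp q q.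
Proof.
by rewrite raddfD /= mxtrace_scalar mxtraceZ mxtrace_rank_one mulr_natr.
Qed.

End rank_one.

(** * Semicontinuous functions *)

Section semicontinuity.
Context {R : realType} {n : nat}.
Implicit Types (D : set 'rV[R]_n) (f : 'rV[R]_n -> R).

Lemma nbhs_subspace_set1 D (x : 'rV[R]_n) :
  ~ D x -> nbhs (x : subspace D) [set x].
Proof.
move=> Dx; have : globally [set x] [set x] by [].
by rewrite (nbhs_subspace_out Dx).
Qed.

(** Points outside [D] are isolated in [subspace D], so semicontinuity is automatic there and only
    neighbourhoods within [D] of points of [D] matter. *)
Lemma lsc_onP D f : lsc_on D f <->
  forall x, D x -> forall b, b < f x ->
    \forall y \near within D (nbhs x), b < f y.
Proof.
split=> [lf x Dx b bf|lf x b bf].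
  have /(_ x b) := lf; rewrite /= lte_fin => /(_ bf)[V + VP].
  move=> VD; have {}VD : within D (nbhs x) V by rewrite nbhs_subspace_in.
  by apply: filterS VD => y /VP.
have [Dx|Dx] := pselect (D x).
  exists [set y | b < f y]; last by move=> y; rewrite /= lte_fin.
  have : within D (nbhs (x : 'rV[R]_n)) [set y | b < f y].
    by apply: (lf x Dx b); rewrite -lte_fin.
  by rewrite nbhs_subspace_in.
exists [set x]; last by move=> y ->.
exact: nbhs_subspace_set1.
Qed.

(** The sublevel sets at values of [f] generate a proper filter, which clusters at some [p] by
    compactness. If [f y < f p], lower semicontinuity keeps a neighbourhood of [p] away from the
    sublevel set of [f y]. *)
Lemma lsc_attains_min D f : D !=set0 -> compact D -> lsc_on D f ->
  exists2 x, D x & forall y, D y -> f x <= f y.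
Proof.
move=> [x0 Dx0] cD /lsc_onP lf.
pose F := filter_from D (fun y => [set z | D z /\ f z <= f y]).
have FF : ProperFilter F.
  apply: filter_from_proper; last by move=> y Dy; exists y.
  apply: filter_from_filter; first by exists x0.
  move=> y z Dy Dz; have [yz|/ltW zy] := leP (f y) (f z).
    by exists y => // t [Dt ty]; split; split=> //; exact: le_trans yz.
  by exists z => // t [Dt ty]; split; split=> //; exact: le_trans zy.
have [|p [Dp Fp]] := cD F FF; first by exists x0 => // z [].
exists p => // y Dy; rewrite leNgt; apply/negP => yp.
have Fy : F [set z | D z /\ f z <= f y] by exists y.
have [z [[Dz zy] yz]] := Fp _ _ Fy (lf p Dp _ yp).
by have := lt_le_trans (yz Dz) zy; rewrite ltxx.
Qed.

Lemma closure_compact (O : set 'rV[R]_n) : bounded_set O -> compact (closure O).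
Proof.
move=> [M [Mr MO]]; apply: bounded_closed_compact; last exact: closed_closure.
exists M; split=> // k Mk x Ox.
have clk : closed (closed_ball_ Num.norm (0 : 'rV[R]_n) k).
  exact: closed_closed_ball_.
suff : closed_ball_ Num.norm (0 : 'rV[R]_n) k x.
  by rewrite /closed_ball_ /= sub0r normrN.
rewrite ((closure_id _).1 clk); apply: closure_subset Ox => y Oy.
rewrite /closed_ball_ /= sub0r normrN; exact: (MO k).
Qed.

End semicontinuity.

(** * Exponential test functions and the upper bounds *)

Section directional_derivatives.
Context {R : realType} {n : nat} {W : normedModType R}.
Implicit Types (f : 'rV[R]_n -> W) (x v : 'rV[R]_n).

(** Both difference quotients are the same function of the increment. All calculus in several
    variables below is reduced to one variable along lines in this way. *)
Lemma is_derive_lineP f x v (t : R) df :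
  is_derive (x + t *: v) v f df <-> is_derive t 1 (fun s => f (x + s *: v)) df.
Proof.
have E : (fun h : R => h^-1 *: ((f \o shift (x + t *: v)) (h *: v)
                              - f (x + t *: v))) =
  (fun h => h^-1 *: (((fun s => f (x + s *: v)) \o shift t) (h *: 1)
                              - f (x + t *: v))).
  apply/funext => h /=; rewrite [h%:A]mulr1 scalerDl; congr (_ *: (f _ - _)).
  by rewrite addrCA.
split=> -[df1 df2]; apply: DeriveDef.
- by rewrite /derivable -E.
- by rewrite /derive -E.
- by rewrite /derivable E.
- by rewrite /derive E.
Qed.

End directional_derivatives.

Section gradient.
Context {R : realType} {n : nat}.
Implicit Types (f : 'rV[R]_n -> R) (x v : 'rV[R]_n).

Lemma derive_grad f x v : differentiable f x -> 'D_v f x = dotp (grad f x) v.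
Proof.
move=> fx; rewrite deriveE// [in LHS](row_sum_delta v) linear_sum dotpE.
by apply: eq_bigr => i _; rewrite linearZ mxE deriveE// mulrC.
Qed.

Lemma is_derive_grad f x v :
  differentiable f x -> is_derive x v f (dotp (grad f x) v).
Proof.
by move=> fx; apply: DeriveDef; [exact: diff_derivable|exact: derive_grad].
Qed.

Lemma is_derive_dotp_grad f x v w : differentiable (grad f) x ->
  is_derive x v (fun y => dotp (grad f y) w) (dotp (v *m hessian f x) w).
Proof.
move=> fx.
have coord i : is_derive x v (fun y => grad f y 0 i) ((v *m hessian f x) 0 i).
  have dg : derivable (grad f) x v by exact: diff_derivable.
  apply: DeriveDef; first exact: (derivable_mxP (grad f) x v).1.
  by rewrite -deriveEjacobian// derive_mx// mxE.
have -> : (fun y => dotp (grad f y) w) =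
    \sum_i (w 0 i *: (fun y => grad f y 0 i)).
  apply/funext => y; rewrite dotpE fct_sumE; apply: eq_bigr => i _.
  by rewrite mulrC.
rewrite dotpE (eq_bigr (fun i => w 0 i *: (v *m hessian f x) 0 i)); last first.
  by move=> i _; rewrite mulrC.
by apply: is_derive_sum => i; exact: is_deriveZ.
Qed.

Lemma hessianE f x (M : 'M[R]_n) : differentiable (grad f) x ->
  (forall v, 'D_v (grad f) x = v *m M) -> hessian f x = M.
Proof.
move=> fx fM; apply/row_matrixP => i; rewrite !rowE -fM.
by rewrite deriveEjacobian.
Qed.

End gradient.

Section exponential.
Context {R : realType} {n : nat} (c b : R) (i : 'I_n).

(** The factor [c] rescales the function until it touches, and a negative [c] gives the test
    functions for subsolutions. *)
Definition expcoord (x : 'rV[R]_n) : R := c * expR (b * x 0 i).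

Let e : 'rV[R]_n := delta_mx 0 i.

Lemma differentiable_expcoord x : differentiable expcoord x.
Proof.
have dc : differentiable (fun y : 'rV[R]_n => y 0 i) x.
  exact: differentiable_coord.
have de : differentiable (fun t : R => c * expR (b * t)) (x 0 i).
  apply/derivable1_diffP; apply: derivableZ.
  have := is_derive1_comp (is_derive_expR (b * x 0 i))
    (is_deriveZ b (is_derive_id (x 0 i) (1 : R))).
  by case.
exact: (differentiable_comp dc de).
Qed.

Lemma derive_expcoord x v : 'D_v expcoord x = b * expcoord x * v 0 i.
Proof.
have := is_derive_lineP expcoord x v 0 (b * expcoord x * v 0 i).
rewrite scale0r addr0 => -[_ D]; apply: derive_val; apply: D.
have -> : (fun s : R => expcoord (x + s *: v)) =
    c \*: (expR \o (fun s => b * x 0 i + s *: (b * v 0 i))).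
  apply/funext => s; rewrite /expcoord !mxE /=; congr (_ * expR _).
  by rewrite /GRing.scale /=; ring.
apply: is_derive_eq.
rewrite /= scale0r addr0.
by rewrite /expcoord /GRing.scale /=; ring.
Qed.

Lemma grad_expcoord : grad expcoord = fun x => (b * expcoord x) *: e.
Proof.
apply/funext => x; apply/rowP => j; rewrite !mxE derive_expcoord !mxE eqxx /=.
by rewrite eq_sym.
Qed.

Lemma differentiable_grad_expcoord x : differentiable (grad expcoord) x.
Proof.
rewrite grad_expcoord; apply: differentiableZl; apply: differentiableZ.
exact: differentiable_expcoord.
Qed.

Lemma hessian_expcoord :
  hessian expcoord = fun x => (b ^+ 2 * expcoord x) *: (e^T *m e).
Proof.
apply/funext => x; apply: hessianE; first exact: differentiable_grad_expcoord.
move=> v; rewrite deriveE; last exact: differentiable_grad_expcoord.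
rewrite grad_expcoord diffZl; last first.
  exact/differentiableZ/differentiable_expcoord.
rewrite -deriveE; last exact/differentiableZ/differentiable_expcoord.
rewrite deriveZ; last exact/diff_derivable/differentiable_expcoord.
rewrite derive_expcoord -scalemxAr mulmxA [v *m e^T]mx11_scalar mul_scalar_mx.
rewrite -/(dotp v e) dotp_delta_r scalerA; congr (_ *: _).
by rewrite /GRing.scale /=; ring.
Qed.

Lemma C2_closure_expcoord (O : set 'rV[R]_n) :
  C2_closure O expcoord (fun x => (b * expcoord x) *: e)
    (fun x => (b ^+ 2 * expcoord x) *: (e^T *m e)).
Proof.
have cf : continuous expcoord.
  by move=> x; exact/differentiable_continuous/differentiable_expcoord.
have cZ (V : normedModType R) (k : R) (w : V) :
    continuous (fun x => (k * expcoord x) *: w).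
  move=> x; apply/differentiable_continuous/differentiableZl/differentiableZ.
  exact: differentiable_expcoord.
split.
- move=> x _; split; first exact: differentiable_expcoord.
  + exact: differentiable_grad_expcoord.
  + by rewrite hessian_expcoord; exact: cZ.
- by move=> x _; rewrite grad_expcoord hessian_expcoord.
- exact: continuous_subspaceT.
- exact/continuous_subspaceT/cZ.
- exact/continuous_subspaceT/cZ.
Qed.

End exponential.

Section domain.
Context {R : realType} {n : nat} (O : set 'rV[R]_n).

Lemma boundaryP x : open O -> closure O x -> O x \/ boundary O x.
Proof.
move=> oO clx; have [Ox|Ox] := pselect (O x); first by left.
by right; split=> // /interior_subset.
Qed.

Lemma local_defining_at x U rho : local_defining_function O x U rho ->
  [/\ U x, differentiable rho x & grad rho x != 0].
Proof.
move=> [[oU Ux] rhoC2 grad_neq0 _ _]; split=> //; last exact: grad_neq0.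
by have [] := rhoC2 x Ux.
Qed.

(** The domain condition supplies a defining function at [x], so [xget] picks a normalised gradient
    and not its default value 0. *)
Lemma outer_normalP x : bounded_C2_domain O -> boundary O x ->
  exists U rho, local_defining_function O x U rho /\
    outer_normal O x = (enorm (grad rho x))^-1 *: grad rho x.
Proof.
move=> [_ _ _ _ bO] /bO[U [rho Urho]].
rewrite /outer_normal; case: xgetP => [nu _ [V [sigma [Vsigma ->]]]|].
  by exists V, sigma.
by move=> /(_ ((enorm (grad rho x))^-1 *: grad rho x)); case; exists U, rho.
Qed.

Lemma dotp_normalized (x : 'rV[R]_n) : x != 0 ->
  dotp ((enorm x)^-1 *: x) ((enorm x)^-1 *: x) = 1.
Proof.
move=> x0; rewrite dotpZl dotpZr -enorm_sqr.
by field; rewrite gt_eqF// enorm_gt0.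
Qed.

Lemma outer_normal_unit x : bounded_C2_domain O -> boundary O x ->
  dotp (outer_normal O x) (outer_normal O x) = 1.
Proof.
move=> O_C2 /(outer_normalP O_C2)[U [rho [Urho ->]]].
by have [_ _ ?] := local_defining_at Urho; exact: dotp_normalized.
Qed.

Lemma outer_normal_coord_le1 x i : bounded_C2_domain O -> boundary O x ->
  dotp (delta_mx 0 i) (outer_normal O x) <= 1.
Proof.
move=> O_C2 bx; have := cauchy_schwarz (delta_mx 0 i) (outer_normal O x).
rewrite dotp_delta outer_normal_unit// mulr1 => h.
by nra.
Qed.

End domain.

Section upper_bounds.
Context {R : realType} {n : nat} (a A : R) (O : set 'rV[R]_n) (i : 'I_n).
Hypotheses (O_C2 : bounded_C2_domain O) (a_gt0 : 0 < a) (aA : a <= A).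
Implicit Types (w : 'rV[R]_n -> R).

(** The multiple [t] is the minimum of the quotient of [w] by the positive exponential, attained
    because the quotient is lower semicontinuous on a compact set. *)
Lemma touch_expcoord b w : (forall x, closure O x -> 0 < w x) ->
  lsc_on (closure O) w ->
  exists2 t, 0 < t & exists2 x, closure O x &
    w x = expcoord t b i x /\
    forall y, closure O y -> expcoord t b i y <= w y.
Proof.
move=> w_gt0 /lsc_onP w_lsc.
have [neO _ _ Obnd _] := O_C2.
have u_gt0 x : 0 < expcoord 1 b i x by rewrite /expcoord mul1r expR_gt0.
have [x clx xmin] : exists2 x, closure O x & forall y, closure O y ->
    w x / expcoord 1 b i x <= w y / expcoord 1 b i y.
  apply: lsc_attains_min.
- by have [x Ox] := neO; exists x; exact: subset_closure.
- exact: closure_compact.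
- apply/lsc_onP => x clx k; rewrite ltr_pdivlMr// => kx.
  (* The midpoint separates the two sides: near [x] the continuous one stays below [s] and the
     semicontinuous one above it. *)
  pose s := (k * expcoord 1 b i x + w x) / 2.
  have ks : k * expcoord 1 b i x < s by rewrite midf_lt.
  have cu : {for x, continuous (fun y => k * expcoord 1 b i y)}.
    apply: differentiable_continuous; apply: differentiableZ.
    exact: differentiable_expcoord.
  have u_near : \forall y \near x, k * expcoord 1 b i y < s.
    exact: (cvgr_lt _ cu).
  have sw : s < w x by rewrite midf_lt.
  near=> y; rewrite ltr_pdivlMr//; apply: (@lt_trans _ _ s).
    by near: y; exact: cvg_within.
  by near: y; exact: w_lsc.
exists (w x / expcoord 1 b i x); first by rewrite divr_gt0// w_gt0.
have uE t y : expcoord t b i y = t * expcoord 1 b i y.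
  by rewrite /expcoord mul1r.
exists x => //; split; first by rewrite uE divfK ?gt_eqF.
by move=> y cly; rewrite uE -ler_pdivlMr// xmin.
Unshelve. all: by end_near. Qed.

Lemma supersolution_upper_bound (alpha b lambda : R) w : 0 < b < alpha ->
  (forall x, closure O x -> 0 < w x) ->
  viscosity_supersolution a A O alpha lambda w -> lambda <= - (A * b ^+ 2).
Proof.
move=> /andP[b_gt0 balpha] w_gt0 [w_lsc w_super].
have [t t_gt0 [x clx [wx wt]]] := touch_expcoord b w_gt0 w_lsc.
have [_ O_open _ _ _] := O_C2.
have := w_super _ _ _ (C2_closure_expcoord t b i O) x clx.
rewrite wx; set u := expcoord t b i x.
have u_gt0 : 0 < u by rewrite /u -wx w_gt0.
set M := _ *: _.
have pu : A * b ^+ 2 * u <= pucci a A M.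
  have aAA : a <= A <= A by rewrite aA lexx.
  have := @pucci_ge_scalar R n a A a_gt0 aA A M M aAA (fun=> lexx _).
  by rewrite mxtraceZ mxtrace_rank_one dotp_delta mulr1 mulrA.
have bulk : pucci a A M + lambda * u <= 0 -> lambda <= - (A * b ^+ 2).
  move=> h; rewrite -(ler_pM2r u_gt0) mulNr lerNr -subr_ge0.
  by move: h; rewrite -subr_le0; lra.
move=> [|Oin Obd].
  by near=> y; rewrite wx subrr subr_ge0; apply: wt; near: y; exact: withinT.
have [/Oin/bulk//|bx] := boundaryP O_open clx.
have := Obd bx; rewrite le_max => /orP[|]; first by rewrite oppr_ge0.
rewrite dotpZl; have := outer_normal_coord_le1 i O_C2 bx.
(* The boundary alternative fails strictly, since [b d <= b < alpha]. *)
move: (dotp _ _) => d d1 h; suff : (b * d - alpha) * u < 0 by lra.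
by rewrite nmulr_rlt0// subr_lt0 (le_lt_trans _ balpha)// ler_piMr// ltW.
Unshelve. all: by end_near. Qed.

(** The touching lemma applies to [- w]. The test function for [w] then has coefficient [- t] and a
    negative semidefinite Hessian, which brings in [a] in place of [A]. *)
Lemma subsolution_upper_bound (alpha b lambda : R) w : 0 < b < alpha ->
  (forall x, closure O x -> w x < 0) ->
  viscosity_subsolution a A O alpha lambda w -> lambda <= - (a * b ^+ 2).
Proof.
move=> /andP[b_gt0 balpha] w_lt0 [w_usc w_sub].
have Nw_gt0 x : closure O x -> 0 < - w x.
  by move=> clx; rewrite oppr_gt0 w_lt0.
have [t t_gt0 [x clx [wx wt]]] := touch_expcoord b Nw_gt0 w_usc.
have [_ O_open _ _ _] := O_C2.
have := w_sub _ _ _ (C2_closure_expcoord (- t) b i O) x clx.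
have eN y : expcoord (- t) b i y = - expcoord t b i y.
  by rewrite /expcoord mulNr.
have {}wx : w x = - expcoord t b i x by rewrite -wx opprK.
rewrite wx eN; set u := expcoord t b i x.
have u_gt0 : 0 < u by rewrite -oppr_lt0 /u -wx w_lt0.
set M := (_ *: _).
have pu : pucci a A M <= - (a * b ^+ 2 * u).
  have := @pucci_le_nsd R n a A a_gt0 aA M (- M).
  rewrite opprK => /(_ _ (fun=> lexx _)).
  pose e : 'rV[R]_n := delta_mx 0 i.
  have -> : - M = 0%:M + (b ^+ 2 * u) *: (e^T *m e).
    by rewrite /M mulrN scaleNr opprK raddf0 add0r.
  rewrite mxtrace_scalar_rank_one dotp_delta mul0r add0r mulr1 mulrA; apply.
  by apply: psd_scalar_rank_one => //; rewrite mulr_ge0 ?sqr_ge0 ?ltW.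
have bulk : 0 <= pucci a A M + lambda * - u -> lambda <= - (a * b ^+ 2).
  rewrite mulrN subr_ge0 => h.
  by rewrite -(ler_pM2r u_gt0) mulNr (le_trans h).
move=> [|Oin Obd].
  near=> y; rewrite !eN wx !opprK addNr -lerBrDr sub0r -[w y]opprK lerN2.
  by apply: wt; near: y; exact: withinT.
have [/Oin/bulk//|bx] := boundaryP O_open clx.
have := Obd bx; rewrite ge_min => /orP[|]; first by rewrite oppr_le0.
rewrite dotpZl; have := outer_normal_coord_le1 i O_C2 bx.
move: (dotp _ _) => d d1 h; suff : (b * d - alpha) * u < 0 by lra.
by rewrite nmulr_rlt0// subr_lt0 (le_lt_trans _ balpha)// ler_piMr// ltW.
Unshelve. all: by end_near. Qed.

End upper_bounds.

(** * The uniform interior ball condition *)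

Section taylor.
Context {R : realType}.

(** The mean value theorem is applied to [g] on [[0, 1]] and then to [g1] on [[0, t]]. This gives up
    the factor 1/2 of Taylor's formula, which is harmless here. *)
Lemma second_order_le (g g1 g2 : R -> R) (c : R) : 0 <= c ->
  (forall t : R, 0 <= t <= 1 -> is_derive t 1 g (g1 t)) ->
  (forall t : R, 0 <= t <= 1 -> is_derive t 1 g1 (g2 t)) ->
  (forall t : R, 0 <= t <= 1 -> g2 t <= c) ->
  g 1 <= g 0 + g1 0 + c.
Proof.
move=> c_ge0 dg dg1 g2c.
have cont (h h1 : R -> R) (s : R) : 0 <= s <= 1 ->
    (forall t : R, 0 <= t <= 1 -> is_derive t 1 h (h1 t)) ->
    {within `[0, s], continuous h}.
  move=> /andP[s0 s1] dh; apply: derivable_within_continuous => t.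
  rewrite in_itv/= => /andP[t0 ts].
  by have [] := dh t _; rewrite // t0 (le_trans ts).
have [|||t] := @MVT R g g1 0 1.
- exact: ltr01.
- by move=> t; rewrite in_itv/= => /andP[t0 t1]; apply: dg; rewrite !ltW.
- by apply: (cont _ _ _ _ dg); rewrite ler01 lexx.
rewrite in_itv/= => /andP[t0 t1]; rewrite subr0 mulr1 => gt.
have [|||s] := @MVT R g1 g2 0 t.
- exact: t0.
- move=> s; rewrite in_itv/= => /andP[s0 st]; apply: dg1.
  by apply/andP; split; lra.
- by apply: (cont _ _ _ _ dg1); rewrite !ltW.
rewrite in_itv/= subr0 => /andP[s0 st] g1s.
have : g2 s * t <= c * 1.
  have s01 : 0 <= s <= 1 by apply/andP; split; lra.
  apply: (@le_trans _ _ (c * t)).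
    by apply: ler_wpM2r; [exact: ltW|exact: g2c].
  by rewrite ler_wpM2l// ltW.
lra.
Qed.

Context {n : nat}.

(** Each of the two products costs a factor [n] in the sup norm; the squared sup norm of [h] is then
    bounded by the Euclidean one. *)
Lemma form_le_norm (M : 'M[R]_n) (h : 'rV[R]_n) :
  dotp (h *m M) h <= n%:R ^+ 2 * `|M| * dotp h h.
Proof.
rewrite (le_trans (ler_norm _))// (le_trans (dotp_le_norm _ _))//.
have hM : `|h *m M| <= n%:R * `|h| * `|M|.
  rewrite [leLHS]mx_normrE; apply: bigmax_le => /= [|[i j] _ /=].
    by rewrite !mulr_ge0.
  rewrite mxE (le_trans (ler_norm_sum _ _ _))//.
  apply: (@le_trans _ _ (\sum_(k < n) `|h| * `|M|)); last first.
    by rewrite sumr_const card_ord -mulrA mulr_natl.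
  apply: ler_sum => k _; rewrite normrM ord1 ler_pM ?norm_coord_le//.
  by rewrite [leRHS]mx_normrE; apply/bigmax_geP; right; exists (k, j).
apply: (@le_trans _ _ (n%:R * (n%:R * `|h| * `|M|) * `|h|)).
  by rewrite ler_wpM2r// ler_wpM2l.
rewrite (_ : _ * `|h| = n%:R ^+ 2 * `|M| * `|h| ^+ 2); last by ring.
by rewrite ler_wpM2l ?sqr_norm_le_dotp// mulr_ge0// sqr_ge0.
Qed.

Lemma taylor_upper_bound (rho : 'rV[R]_n -> R) (x : 'rV[R]_n) (d C : R) :
  0 <= C -> C2_on (ball x d) rho ->
  (forall z, ball x d z -> `|hessian rho z| <= C) ->
  forall y z, ball x d y -> ball x d z ->
  rho z <= rho y + dotp (grad rho y) (z - y)
           + n%:R ^+ 2 * C * dotp (z - y) (z - y).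
Proof.
move=> C_ge0 rhoC2 HC y z yB zB; set h := z - y.
(* Balls are convex, so the segment from [y] to [z] stays where the Hessian is bounded. *)
have seg t : 0 <= t <= 1 -> ball x d (y + t *: h).
  move=> /andP[t0 t1]; move: yB zB; rewrite -ball_normE /ball_/= => yB zB.
  rewrite (_ : x - _ = (1 - t) *: (x - y) + t *: (x - z)); last first.
    by rewrite /h; apply/rowP => i; rewrite !mxE; ring.
  rewrite (le_lt_trans (ler_normD _ _))// !normrZ !ger0_norm ?subr_ge0//.
  have : (1 - t) * `|x - y| <= (1 - t) * Num.max `|x - y| `|x - z|.
    by rewrite ler_wpM2l ?subr_ge0// le_max lexx.
  have : t * `|x - z| <= t * Num.max `|x - y| `|x - z|.
    by rewrite ler_wpM2l// le_max lexx orbT.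
  have : Num.max `|x - y| `|x - z| < d by rewrite gt_max yB.
  lra.
have -> : rho z = rho (y + 1 *: h) by rewrite scale1r /h addrC subrK.
have {2 3}-> : y = y + 0 *: h by rewrite scale0r addr0.
pose g2 t := dotp (h *m hessian rho (y + t *: h)) h.
apply: (@second_order_le (fun t => rho (y + t *: h))
  (fun t => dotp (grad rho (y + t *: h)) h) g2).
- by rewrite !mulr_ge0 ?sqr_ge0 ?dotp_ge0.
- move=> t /seg/rhoC2[rho1 _ _]; apply/is_derive_lineP.
  exact: is_derive_grad.
- move=> t /seg/rhoC2[_ rho2 _].
  apply/(is_derive_lineP (fun u => dotp (grad rho u) h)).
  exact: is_derive_dotp_grad.
- move=> t /seg/HC Ht; rewrite (le_trans (form_le_norm _ _))//.
  by rewrite ler_wpM2r ?dotp_ge0// ler_wpM2l ?sqr_ge0.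
Qed.

End taylor.

Section interior_ball.
Context {R : realType} {n : nat} (O : set 'rV[R]_n).
Hypothesis O_C2 : bounded_C2_domain O.

(** Here [p = |h|^2] and [q = <h, nu>] with [h = z - y]. The last hypothesis puts [z] in the ball of
    radius [r] about [y - r nu], and the conclusion bounds [|h|] by the diameter. *)
Lemma half_space_sqr_lt (p q r : R) : 0 < r -> 0 <= p -> q ^+ 2 <= p ->
  p + 2 * r * q < 0 -> p < (2 * r) ^+ 2.
Proof.
move=> r_gt0 p0 qp pq; rewrite ltNge; apply/negP => rp.
have h1 : 0 < (- (2 * r * q) - p) * (- (2 * r * q) + p).
  by apply: mulr_gt0; lra.
have h2 : (2 * r) ^+ 2 * q ^+ 2 <= (2 * r) ^+ 2 * p.
  by rewrite ler_wpM2l ?sqr_ge0.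
have h3 : (2 * r) ^+ 2 * p <= p * p by rewrite ler_wpM2r.
have : (- (2 * r * q) - p) * (- (2 * r * q) + p) =
    (2 * r) ^+ 2 * q ^+ 2 - p * p by ring.
lra.
Qed.

(** In the same notation, [g] is the length of the gradient and [K p] the Taylor remainder. Inside
    the ball [p < - 2 r q], so for small [r] the negative first-order term dominates. *)
Lemma half_space_taylor_lt0 (p q r g m K : R) : 0 < r -> 0 <= K -> 0 < m ->
  m <= g -> 0 <= p -> p + 2 * r * q < 0 -> r * ((K + 1) * 2) < m ->
  g * q + K * p < 0.
Proof.
move=> r0 K0 m0 mg p0 pq rK.
have q0 : q < 0 by rewrite -(pmulr_rlt0 _ (_ : 0 < 2 * r)); lra.
have h1 : (g - m) * (- q) >= 0 by rewrite mulr_ge0; lra.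
have h2 : m * (p + 2 * r * q) < 0 by rewrite pmulr_rlt0.
have h3 : 0 <= (m - r * ((K + 1) * 2)) * p by rewrite mulr_ge0; lra.
have h4 : 0 <= r * p by rewrite mulr_ge0// ltW.
have h5 : 0 <= r * ((g - m) * (- q)) by rewrite mulr_ge0// ltW.
rewrite -(pmulr_rlt0 _ (_ : 0 < 2 * r)); last by lra.
rewrite (_ : _ * _ = - (2 * (r * ((g - m) * (- q)))) + m * (p + 2 * r * q)
  - (m - r * ((K + 1) * 2)) * p - 2 * (r * p)); last by ring.
lra.
Qed.

Lemma dotp_add_unit (h nu : 'rV[R]_n) r : dotp nu nu = 1 ->
  dotp (h + r *: nu) (h + r *: nu) = dotp h h + 2 * r * dotp h nu + r ^+ 2.
Proof.
by move=> nu1; rewrite !(dotpDl, dotpDr, dotpZl, dotpZr) nu1 (dotpC nu h); ring.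
Qed.

Definition euclidean_ball (c : 'rV[R]_n) (r : R) : set 'rV[R]_n :=
  [set z | dotp (z - c) (z - c) < r ^+ 2].

Definition interior_ball_at r y :=
  exists2 c, dotp (y - c) (y - c) <= r ^+ 2 & euclidean_ball c r `<=` O.

(* With [nu] the normalised gradient of a local defining function, the ball of
   radius [r] around [y - r nu] works even when [y] is not on the boundary,
   because [rho y <= 0]. *)
Lemma interior_ball_near x : closure O x ->
  \forall y \near x & r \near 0^'+, closure O y -> interior_ball_at r y.
Proof.
move=> clx; have [_ O_open _ _ O_bd] := O_C2.
have [Ox|bx] := boundaryP O_open clx.
  have /nbhs_ballP[d /= d_gt0 dO] : nbhs x O by apply: open_nbhs_nbhs.
  near=> y r => _; exists y; first by rewrite subrr dotp0l sqr_ge0.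
  move=> z; rewrite /euclidean_ball/= => zr; apply: dO.
  have r_gt0 : 0 < r by near: r; exact: nbhs_right_gt.
  have rd : r < d / 2 by near: r; apply: nbhs_right_lt; rewrite divr_gt0.
  have yd : `|x - y| < d / 2.
    by near: y; apply: (@cvgr_dist_lt _ _ _ _ _ id x); rewrite ?divr_gt0.
  rewrite -ball_normE /ball_/= -(subrKA y) (le_lt_trans (ler_normD _ _))//.
  have : `|y - z| < r.
    rewrite distrC -ltr_sqr ?nnegrE// ?ltW//.
    by rewrite (le_lt_trans (sqr_norm_le_dotp _)).
  lra.
have [U [rho [[U_open Ux] rhoC2 grad_neq0 UO UbO]]] := O_bd x bx.
have [rho_diff grad_diff hess_cont] := rhoC2 x Ux.
pose C := `|hessian rho x| + 1.
pose m := `|grad rho x| / 2.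
have m_gt0 : 0 < m by rewrite divr_gt0// normr_gt0 grad_neq0.
have C_gt0 : 0 < C by rewrite ltr_wpDl.
(* With the Taylor constant [K = n^2 C], the condition [r < m / C'] is the smallness required by
   [half_space_taylor_lt0]. *)
pose C' := (n%:R ^+ 2 * C + 1) * 2.
have C'_gt0 : 0 < C' by rewrite mulr_gt0// ltr_wpDl// mulr_ge0 ?sqr_ge0// ltW.
have : \forall y \near x, [/\ U y, `|hessian rho y| <= C & m <= `|grad rho y|].
  near=> y; split.
  - by near: y; exact: open_nbhs_nbhs.
  - by near: y; apply: (cvgr_norm_le _ hess_cont); rewrite ltrDl.
  - near: y; apply: (cvgr_norm_ge _ (differentiable_continuous grad_diff)).
    by rewrite ltr_pdivrMr// ltr_pMr ?normr_gt0 ?grad_neq0// ltr1n.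
move=> /nbhs_ballP[d /= d_gt0 dP].
near=> y r => cly.
have r_gt0 : 0 < r by near: r; exact: nbhs_right_gt.
(* Points of the ball lie within [2 r] of [y], and [y] within [d / 2] of [x], so the whole ball
   stays in [ball x d]. *)
have rd : r < d / 4 by near: r; apply: nbhs_right_lt; rewrite divr_gt0.
have rm : r < m / C' by near: r; apply: nbhs_right_lt; rewrite divr_gt0.
have yd : `|x - y| < d / 2.
  by near: y; apply: (@cvgr_dist_lt _ _ _ _ _ id x); rewrite ?divr_gt0.
have yB : ball x d y by rewrite -ball_normE /ball_/=; lra.
have [Uy _ my] := dP y yB.
set G := grad rho y in my.
have G_neq0 : G != 0 by exact: grad_neq0.
have G_gt0 : 0 < enorm G by exact: enorm_gt0.
have mG : m <= enorm G.
  rewrite (le_trans my)// -ler_sqr ?nnegrE ?enorm_ge0// enorm_sqr.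
  exact: sqr_norm_le_dotp.
have [nu nu1 GE] : exists2 nu, dotp nu nu = 1 & G = enorm G *: nu.
  exists ((enorm G)^-1 *: G); first exact: dotp_normalized.
  by rewrite scalerA divff ?scale1r ?gt_eqF.
exists (y - r *: nu).
  by rewrite opprB addrC subrK dotpZl dotpZr nu1 mulr1 expr2.
move=> z; rewrite /euclidean_ball /=.
have -> : z - (y - r *: nu) = (z - y) + r *: nu by rewrite opprB addrA addrAC.
rewrite dotp_add_unit//.
have := cauchy_schwarz (z - y) nu; rewrite nu1 mulr1.
have := dotp_ge0 (z - y).
have Gh : dotp G (z - y) = enorm G * dotp (z - y) nu.
  by rewrite {1}GE dotpZl dotpC.
have znorm := sqr_norm_le_dotp (z - y).
have taylor := @taylor_upper_bound R n rho x d C (ltW C_gt0) _ _ y z yB.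
move: taylor; rewrite -/G Gh.
move: znorm (dotp (z - y) nu); set p := dotp (z - y) (z - y).
move=> zp q taylor p0 qp ltr.
have zd : `|z - y| < 2 * r.
  have r2_ge0 : 0 <= 2 * r by rewrite mulr_ge0// ltW.
  rewrite -ltr_sqr ?nnegrE// (le_lt_trans zp)//.
  have : p + 2 * r * q < 0 by lra.
  exact: half_space_sqr_lt.
have zB : ball x d z.
  rewrite -ball_normE /ball_/= -(subrKA y) (le_lt_trans (ler_normD _ _))//.
  by rewrite [`|y - z|]distrC; lra.
have [Uz _ _] := dP z zB.
suff : (O `&` U) z by case.
rewrite UO; split=> //=.
have rho_y : rho y <= 0.
  have [Oy|by_] := boundaryP O_open cly.
    have : (O `&` U) y by [].
    by rewrite UO => -[/ltW].
  have : (boundary O `&` U) y by [].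
  by rewrite UbO => -[-> _].
have {}taylor : rho z <= rho y + enorm G * q + n%:R ^+ 2 * C * p.
  apply: taylor; last exact: zB.
  - by move=> u /dP[Uu _ _]; exact: rhoC2.
  - by move=> u /dP[_ Hu _]; exact: Hu.
have pq : p + 2 * r * q < 0 by rewrite -(ltrD2r (r ^+ 2)) add0r.
rewrite (le_lt_trans taylor)//.
have K_ge0 : 0 <= n%:R ^+ 2 * C by rewrite mulr_ge0 ?sqr_ge0// ltW.
rewrite ltr_pdivlMr// in rm.
have := half_space_taylor_lt0 r_gt0 K_ge0 m_gt0 mG p0 pq rm.
by move: rho_y; clear; lra.
Unshelve. all: by end_near. Qed.

(** The local statement holds jointly for [y] near [x] and small [r], so compactness of the closure
    yields one radius for all points. *)
Lemma uniform_interior_ball :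
  exists2 r, 0 < r & forall y, closure O y -> interior_ball_at r y.
Proof.
have [_ _ _ Obnd _] := O_C2.
have /compact_near_coveringP cov := closure_compact Obnd.
have near_r : \forall r \near 0^'+,
    closure O `<=` [set y | closure O y -> interior_ball_at r y].
  by apply: (cov R 0^'+ (fun r y => closure O y -> interior_ball_at r y));
    exact: interior_ball_near.
near (0 : R)^'+ => r.
exists r; first by near: r; exact: nbhs_right_gt.
have rP : closure O `<=` [set y | closure O y -> interior_ball_at r y].
  by near: r.
by move=> y cly; exact: rP.
Unshelve. all: by end_near. Qed.

End interior_ball.

(** * Touching the barrier *)

Section one_sided.
Context {R : realType}.
Implicit Types g : R -> R.

Lemma near_right0P (P : R -> Prop) : (\forall t \near 0^'+, P t) ->
  exists2 s : R, 0 < s & forall t : R, 0 < t < s -> P t.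
Proof.
move=> /nbhs_ballP[s /= s0 sP]; exists s => // t /andP[t0 ts].
by apply: sP => //; rewrite /ball /= sub0r normrN gtr0_norm.
Qed.

Lemma near_at_right (x : R) (P : R -> Prop) :
  (\forall t \near x, P t) -> \forall t \near x^'+, P t.
Proof. by move=> xP; apply: cvg_within xP. Qed.

(** The mean value theorem on [[0, t]] asks for derivatives only at positive times. This suits
    boundary points, where a test function is differentiable only inside the domain. *)
Lemma decreasing_at_right0 g (g1 : R -> R) :
  (\forall t \near 0^'+, is_derive (t : R) 1 g (g1 t)) ->
  (\forall t \near 0^'+, g1 t < 0) -> g t @[t --> 0^'+] --> g 0 ->
  \forall t \near 0^'+, g t < g 0.
Proof.
move=> dg g1_lt0 g_cvg.
have [s s0 sP] : exists2 s : R, 0 < s & forall t : R, 0 < t < s ->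
    is_derive t 1 g (g1 t) /\ g1 t < 0.
  by apply: near_right0P; near=> t; split; near: t.
near=> t.
have t0 : 0 < t by near: t; exact: nbhs_right_gt.
have ts : t < s by near: t; exact: nbhs_right_lt.
have dgu u : 0 < u -> u <= t -> is_derive u 1 g (g1 u).
  by move=> u0 ut; have [] := sP u _; rewrite // u0 (le_lt_trans ut).
have cu u : 0 < u -> u <= t -> {for u, continuous g}.
  move=> u0 ut; apply: differentiable_continuous; apply/derivable1_diffP.
  by have [] := dgu u u0 ut.
have [|||u] := @MVT R g g1 0 t.
- exact: t0.
- by move=> u; rewrite in_itv/= => /andP[u0 ut]; apply: dgu => //; exact: ltW.
- apply/continuous_within_itvP => //; split => //.
    by move=> u; rewrite in_itv/= => /andP[u0 ut]; apply: cu => //; exact: ltW.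
  by apply: cvg_at_left_filter; exact: cu.
rewrite in_itv/= subr0 => /andP[u0 ut] gt.
have [_ g1u] : is_derive u 1 g (g1 u) /\ g1 u < 0.
  by apply: sP; rewrite u0 (lt_trans ut).
by rewrite -subr_lt0 gt nmulr_rlt0.
Unshelve. all: by end_near. Qed.

Lemma derive_lt0_at_right0 g (d : R) : is_derive (0 : R) 1 g d -> d < 0 ->
  \forall t \near 0^'+, g t < g 0.
Proof.
move=> [dg gd] d_lt0.
have qcvg : h^-1 *: ((g \o shift 0) (h *: (1 : R)) - g 0) @[h --> 0^'] --> d.
  by rewrite -gd; exact: dg.
have /cvgr_lt :
    h^-1 *: ((g \o shift 0) (h *: (1 : R)) - g 0) @[h --> 0^'+] --> d.
  exact: cvg_dnbhs_at_right qcvg.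
move=> /(_ _ d_lt0) q_lt0; near=> t.
have t0 : 0 < t by near: t; exact: nbhs_right_gt.
have : t^-1 *: ((g \o shift 0) (t *: (1 : R)) - g 0) < 0 by near: t.
by rewrite /= addr0 [t%:A]mulr1 pmulr_rlt0 ?invr_gt0// subr_lt0.
Unshelve. all: by end_near. Qed.

Lemma derive_le0_at_right0 g (d : R) : is_derive (0 : R) 1 g d ->
  (\forall t \near 0^'+, g t <= g 0) -> d <= 0.
Proof.
move=> dg g_le; rewrite leNgt; apply/negP => d_gt0.
have dNg : is_derive (0 : R) 1 (- g) (- d) by exact: is_deriveN.
have Ng := derive_lt0_at_right0 dNg (_ : - d < 0).
have : \forall t \near (0:R)^'+, False.
  near=> t.
  have : g t <= g 0 by near: t.
  have : - g t < - g 0 by near: t; apply: Ng; rewrite oppr_lt0.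
  by rewrite ltrN2 => /lt_le_trans/[apply]; rewrite ltxx.
by move=> /filter_ex[].
Unshelve. all: by end_near. Qed.

(** At the minimum [g1] vanishes; if [d] were negative, [g1] would be negative just to the right of
    0 and [g] would drop below [g 0]. *)
Lemma second_derive_ge0_at_min g (g1 : R -> R) (d : R) :
  (\forall t \near (0 : R), is_derive (t : R) 1 g (g1 t)) ->
  is_derive (0 : R) 1 g1 d -> (\forall t \near (0 : R), g 0 <= g t) -> 0 <= d.
Proof.
move=> dg dg1 gmin; rewrite leNgt; apply/negP => d_lt0.
have g10 : g1 0 = 0.
  have [s s0 sP] : exists2 s : R, 0 < s & forall t : R, `|t| < s ->
      is_derive t 1 g (g1 t) /\ g 0 <= g t.
    have : \forall t \near (0 : R), is_derive (t : R) 1 g (g1 t) /\ g 0 <= g t.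
      by near=> t; split; near: t.
    move=> /nbhs_ballP[s /= s0 sP]; exists s => // t ts.
    by apply: sP; rewrite /ball /= sub0r normrN.
  have itvs t : t \in `]-s, s[ -> `|t| < s.
    by rewrite in_itv/= ltr_norml.
  have : is_derive (0 : R) 1 g 0.
    apply: (@derive1_at_min R g (- s) s 0).
    - by rewrite ge0_cp ?ltW.
    - by move=> t /itvs/sP[[]].
    - by rewrite in_itv/= oppr_lt0 s0.
    - by move=> t /itvs/sP[].
  have [[_ <-] _] : is_derive (0 : R) 1 g (g1 0) /\ g 0 <= g 0.
    by apply: sP; rewrite normr0.
  by case.
have g1_lt0 : \forall t \near 0^'+, g1 t < 0.
  by have := derive_lt0_at_right0 dg1 d_lt0; rewrite g10.
have dg_right : \forall t \near (0 : R)^'+, is_derive (t : R) 1 g (g1 t).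
  exact: near_at_right dg.
have g_cvg : g t @[t --> 0^'+] --> g 0.
  apply: cvg_at_right_filter; apply: differentiable_continuous.
  by apply/derivable1_diffP; have [] := nbhs_singleton dg.
have g_lt := decreasing_at_right0 dg_right g1_lt0 g_cvg.
have : \forall t \near (0:R)^'+, False.
  near=> t.
  have : g 0 <= g t by near: t; exact: near_at_right gmin.
  have : g t < g 0 by near: t.
  by move=> /lt_le_trans/[apply]; rewrite ltxx.
by move=> /filter_ex[].
Unshelve. all: by end_near. Qed.

End one_sided.

(** * Nearest centers and tangency of interior balls *)

Section barrier_geometry.
Context {R : realType} {n : nat} (O : set 'rV[R]_n).
Hypothesis O_C2 : bounded_C2_domain O.
Implicit Types (x c : 'rV[R]_n) (r : R).

Lemma continuous_dotp (h : 'rV[R]_n) : continuous (fun u => dotp u h).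
Proof.
move=> c; apply: differentiable_continuous.
have -> : (fun u => dotp u h) = \sum_i (h 0 i *: (fun c : 'rV[R]_n => c 0 i)).
  apply/funext => u; rewrite dotpE fct_sumE; apply: eq_bigr => i _.
  by rewrite mulrC.
apply: differentiable_sum => i; apply: differentiableZ.
exact: differentiable_coord.
Qed.

Lemma near_line x (h : 'rV[R]_n) (P : set 'rV[R]_n) : nbhs x P ->
  \forall t \near (0 : R), P (x + t *: h).
Proof.
have c : {for 0, continuous (fun t : R => x + t *: h)}.
  by apply: continuousD; [exact: cst_continuous|exact: scalel_continuous].
by move=> xP; apply: c; rewrite scale0r addr0.
Qed.

Definition ball_centers r : set 'rV[R]_n :=
  [set c | euclidean_ball c r `<=` O].

Definition nearest_center_at r x c :=
  [/\ ball_centers r c, dotp (x - c) (x - c) <= r ^+ 2 &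
    forall c', ball_centers r c' ->
      dotp (x - c) (x - c) <= dotp (x - c') (x - c')].

Definition nearest_center r (center : 'rV[R]_n -> 'rV[R]_n) :=
  forall x, closure O x -> nearest_center_at r x (center x).

Lemma continuous_sqr_dist x : continuous (fun c => dotp (x - c) (x - c)).
Proof.
move=> c; apply: differentiable_continuous.
have -> : (fun c => dotp (x - c) (x - c)) =
    \sum_i ((cst (x 0 i) - (fun c : 'rV[R]_n => c 0 i)) ^+ 2).
  apply/funext => u; rewrite dotpE fct_sumE; apply: eq_bigr => i _.
  by rewrite !mxE expr2.
apply: differentiable_sum => i; apply: differentiableX.
apply: differentiableB; first exact: differentiable_cst.
exact: differentiable_coord.
Qed.

(** Centers lie in [O], so they form a bounded set. It is closed because the balls are open: a point
    of the ball about a limit center lies in the balls about nearby centers. The squared distance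
    thus attains its minimum. *)
Lemma nearest_ball_center r x : 0 < r -> interior_ball_at O r x ->
  exists c, nearest_center_at r x c.
Proof.
move=> r_gt0 [c0 xc0 c0K].
have [_ _ _ [M [Mr OM]] _] := O_C2.
have K_bnd : bounded_set (ball_centers r).
  exists M; split=> // k /OM Ok c cK; apply: Ok; apply: cK.
  by rewrite /euclidean_ball /= subrr dotp0l exprn_gt0.
have K_closed : closed (ball_centers r).
  move=> c clc z zc.
  have : \forall c' \near c, dotp (z - c') (z - c') < r ^+ 2.
    have cz : {for c, continuous (fun c' => dotp (z - c') (z - c'))}.
      exact: continuous_sqr_dist.
    exact: (cvgr_lt _ cz).
  by move=> /clc[c' [c'K zc']]; exact: c'K.
have [||c] := @EVT_min_rV R n (fun c => dotp (x - c) (x - c)) (ball_centers r) _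
    (bounded_closed_compact K_bnd K_closed).
- by exists c0.
- by apply: continuous_subspaceT; exact: continuous_sqr_dist.
rewrite inE => cK cmin; exists c; split=> //.
  by apply: le_trans xc0; apply: cmin; rewrite inE.
by move=> c' c'K; apply: cmin; rewrite inE.
Qed.

(** Put [q = x - c] and [h = nu - q / r]. If [<q, nu> < r], then [h] points into the ball, so [rho]
    is nonpositive along it and [<nu, h> <= 0], contrary to [<nu, h> = 1 - <q, nu> / r]. Hence
    [<q, nu> >= r], the equality case of Cauchy-Schwarz. *)
Lemma interior_ball_tangent r c x : 0 < r -> ball_centers r c ->
  boundary O x -> dotp (x - c) (x - c) = r ^+ 2 ->
  x - c = r *: outer_normal O x.
Proof.
move=> r_gt0 cK bx xc; have [_ O_open _ _ _] := O_C2.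
have [U [rho [Urho nuE]]] := outer_normalP O_C2 bx.
have nu1 := outer_normal_unit O_C2 bx.
set nu := outer_normal O x in nuE nu1 *.
have [Ux rho_diff grad_neq0] := local_defining_at Urho.
have [[U_open _] _ _ UO UbO] := Urho.
have rho0 : rho x = 0.
  have : (boundary O `&` U) x by [].
  by rewrite UbO => -[].
have [q qE] : exists q, q = x - c by exists (x - c).
rewrite -qE in xc *.
have [h hE] : exists h, h = nu - r^-1 *: q by exists (nu - r^-1 *: q).
have qh : dotp q h = dotp q nu - r.
  rewrite hE dotpBr dotpZr xc; congr (_ - _).
  by rewrite expr2 mulKf// gt_eqF.
have [qnu|nuq] := leP r (dotp q nu).
  suff -> : q = q - r *: nu + r *: nu.
    rewrite (dotp_eq0 (x := q - r *: nu)) ?add0r//.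
    apply/eqP; rewrite eq_le dotp_ge0 andbT.
    rewrite !(dotpBl, dotpBr, dotpZl, dotpZr) xc nu1 (dotpC nu).
    rewrite (_ : _ - _ = 2 * r * (r - dotp q nu)); last by ring.
    by rewrite pmulr_rle0 ?subr_le0// mulr_gt0.
  by rewrite subrK.
have line : \forall t \near 0^'+, rho (x + t *: h) <= rho (x + 0 *: h).
  have hh := dotp_ge0 h.
  have xU : \forall t \near (0 : R)^'+, U (x + t *: h).
    have : \forall t \near (0 : R), U (x + t *: h).
      by apply: near_line; exact: open_nbhs_nbhs.
    exact: near_at_right.
  near=> t.
  have t0 : 0 < t by near: t; exact: nbhs_right_gt.
  have Ut : U (x + t *: h) by near: t.
  rewrite scale0r addr0 rho0.
  have : (O `&` U) (x + t *: h).
    split=> //; apply: cK; rewrite /euclidean_ball/=.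
    rewrite addrAC -qE !(dotpDl, dotpDr, dotpZl, dotpZr) xc (dotpC h) qh.
    have td : t * (dotp h h + 1) < 2 * (r - dotp q nu).
      rewrite -ltr_pdivlMr ?ltr_wpDl//; near: t; apply: nbhs_right_lt.
      by rewrite divr_gt0 ?ltr_wpDl// mulr_gt0// subr_gt0.
    rewrite -subr_lt0.
    rewrite (_ : _ - _ = t * (t * dotp h h - 2 * (r - dotp q nu))); last first.
      by ring.
    rewrite pmulr_rlt0//; lra.
  by rewrite UO => -[/ltW].
have dl : is_derive (0 : R) 1 (fun t => rho (x + t *: h)) (dotp (grad rho x) h).
  by apply/is_derive_lineP; rewrite scale0r addr0; exact: is_derive_grad.
have := derive_le0_at_right0 dl line.
have G_gt0 := enorm_gt0 grad_neq0.
have -> : grad rho x = enorm (grad rho x) *: nu.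
  by rewrite nuE scalerA divff ?scale1r ?gt_eqF.
rewrite dotpZl pmulr_rle0// hE dotpBr dotpZr nu1 (dotpC nu) subr_le0.
rewrite -ler_pdivrMl ?invr_gt0// invrK mulr1 => /le_lt_trans/(_ nuq).
by rewrite ltxx.
Unshelve. all: by end_near. Qed.

End barrier_geometry.

Section gaussian_line.
Context {R : realType}.
Implicit Types k p b d t : R.

(** The restriction of [exp (k |y - c|^2)] to the line [x + t h], with [p = |x - c|^2],
    [b = <x - c, h>] and [d = |h|^2]. *)
Definition expquad k p b d t := expR (k * (p + 2 * b * t + d * t ^+ 2)).

Lemma is_derive_expquad k p b d t :
  is_derive t 1 (expquad k p b d) (k * (2 * b + 2 * d * t) * expquad k p b d t).
Proof.
have -> : expquad k p b d =
    expR \o (k \*: (cst p + (2 * b) \*: id + d \*: (id ^+ 2))).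
  by apply/funext.
apply: is_derive_eq; rewrite !fctE /= /GRing.scale /=.
by ring.
Qed.

Lemma is_derive_expquad1 k p b d :
  is_derive (0 : R) 1 (fun t => k * (2 * b + 2 * d * t) * expquad k p b d t)
    ((2 * k * d + 4 * k ^+ 2 * b ^+ 2) * expR (k * p)).
Proof.
have -> : (fun t => k * (2 * b + 2 * d * t) * expquad k p b d t) =
    (k \*: (cst (2 * b) + (2 * d) \*: id)) * expquad k p b d.
  by apply/funext.
have D := is_derive_expquad k p b d 0.
apply: is_derive_eq; rewrite !fctE /expquad /= /GRing.scale /=.
rewrite expr0n /= !mulr0 !addr0.
by ring.
Qed.

End gaussian_line.

Section barrier.
Context {R : realType} {n : nat} (O : set 'rV[R]_n) (r alpha : R).
Implicit Types x y c h : 'rV[R]_n.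
Hypotheses (O_C2 : bounded_C2_domain O) (r_gt0 : 0 < r) (alpha_gt0 : 0 < alpha).
Variable center : 'rV[R]_n -> 'rV[R]_n.
Hypothesis centerP : nearest_center O r center.

(** Chosen so that [2 k r = alpha], the logarithmic normal derivative at distance [r] from the
    center. *)
Let k := alpha / (2 * r).
Let k_gt0 : 0 < k. Proof. by rewrite divr_gt0// mulr_gt0. Qed.

(* [barrier] is the infimum over all admissible centers [c] of the smooth
   functions [y |-> expR (k |y - c|^2)], so at [x] it is touched from above by
   the one with [c = center x]. *)
Definition barrier x := expR (k * dotp (x - center x) (x - center x)).

Lemma barrier_gt0 x : 0 < barrier x. Proof. exact: expR_gt0. Qed.

Lemma barrier_le x c : closure O x -> ball_centers O r c ->
  barrier x <= expR (k * dotp (x - c) (x - c)).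
Proof.
by move=> /centerP[_ _ cmin] /cmin h; rewrite ler_expR ler_wpM2l// ltW.
Qed.

Lemma barrier_bounded e : `|e| <= 1 -> [bounded e * barrier x | x in closure O].
Proof.
move=> e1; exists (expR (k * r ^+ 2)); split; first exact: num_real.
move=> M M_gt x /centerP[_ xr _] /=; rewrite (le_trans _ (ltW M_gt))//.
rewrite normrM (gtr0_norm (barrier_gt0 x)) -[leRHS]mul1r.
by rewrite ler_pM ?(ltW (barrier_gt0 x))// ler_expR ler_wpM2l// ltW.
Qed.

Lemma expquad_line x c h (t : R) :
  expR (k * dotp (x + t *: h - c) (x + t *: h - c)) =
  expquad k (dotp (x - c) (x - c)) (dotp (x - c) h) (dotp h h) t.
Proof.
have -> : x + t *: h - c = (x - c) + t *: h by rewrite addrAC.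
move: (x - c) => q.
rewrite !(dotpDl, dotpDr, dotpZl, dotpZr) (dotpC h q) /expquad.
by congr (expR (k * _)); ring.
Qed.

(** An infimum of continuous functions need not be lower semicontinuous, so a uniform estimate is
    used: the center of [y] competes at [x], which gives [barrier x <= barrier y * exp (k m y)] with
    [m] vanishing at [x]. *)
Lemma barrier_lsc : lsc_on (closure O) barrier.
Proof.
apply/lsc_onP => x clx b bx.
(* Bounds the increase of the squared distance to [center y] from [y] to [x], knowing that [y] is
   within [r] of that center. *)
pose m y := n%:R * `|x - y| * (2 * r + `|x - y|).
have bm : forall y, closure O y -> barrier x * expR (- (k * m y)) <= barrier y.
  move=> y cly; have [cK yr _] := centerP cly.
  rewrite expRN ler_pdivrMr ?expR_gt0// (le_trans (barrier_le clx cK))//.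
  rewrite -expRD ler_expR -mulrDr ler_wpM2l ?(ltW k_gt0)//.
  have -> : x - center y = (y - center y) + (x - y).
    by rewrite [RHS]addrC subrKA.
  have qr : `|y - center y| <= r.
    rewrite -ler_sqr ?nnegrE// ?(ltW r_gt0)//.
    exact: le_trans (sqr_norm_le_dotp _) _.
  rewrite /m; move: (y - center y) (x - y) qr => q h qr.
  rewrite dotpDl !dotpDr (dotpC h q).
  have h1 := le_trans (ler_norm _) (dotp_le_norm h h).
  have h2 := le_trans (ler_norm _) (dotp_le_norm q h).
  have h3 : n%:R * `|q| * `|h| <= n%:R * r * `|h|.
    by rewrite ler_wpM2r// ler_wpM2l.
  have -> : n%:R * `|h| * (2 * r + `|h|) =
      2 * (n%:R * r * `|h|) + n%:R * `|h| * `|h| by ring.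
  by lra.
have cn : {for x, continuous (fun y => `|x - y|)}.
  apply: (@continuous_comp _ _ _ (fun y => x - y) Num.norm).
    by apply: continuousB; [exact: cst_continuous|exact: cvg_id].
  exact: norm_continuous.
have cm : {for x, continuous m}.
  apply: continuousM.
    by apply: continuousM; [exact: cst_continuous|exact: cn].
  by apply: continuousD; [exact: cst_continuous|exact: cn].
have lim : {for x, continuous (fun y => barrier x * expR (- (k * m y)))}.
  apply: continuousM; first exact: cst_continuous.
  apply: (@continuous_comp _ _ _ (fun y => - (k * m y)) expR).
    apply: continuousN.
    by apply: continuousM; [exact: cst_continuous|exact: cm].
  exact: continuous_expR.
have b_lt : \forall y \near x, b < barrier x * expR (- (k * m y)).
  apply: (cvgr_gt _ lim).
  by rewrite /m subrr normr0 mulr0 mul0r mulr0 oppr0 expR0 mulr1.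
near=> y; apply: (@lt_le_trans _ _ (barrier x * expR (- (k * m y)))).
  by near: y; exact: cvg_within.
by apply: bm; near: y; exact: withinT.
Unshelve. all: by end_near. Qed.

(* The sign [e] is [1] for the supersolution [barrier] and [-1] for the
   subsolution [- barrier]. *)
Section touching.
Variables (e : R) (phi : 'rV[R]_n -> R) (G : 'rV[R]_n -> 'rV[R]_n).
Variables (H : 'rV[R]_n -> 'M[R]_n) (x : 'rV[R]_n).
Hypotheses (phiC2 : C2_closure O phi G H) (clx : closure O x).
Hypothesis touch : local_min_on (closure O) (fun y => barrier y - e * phi y) x.

Let q := x - center x.
Let line h t :=
  expquad k (dotp q q) (dotp q h) (dotp h h) t - e * phi (x + t *: h).
Let line1 h t :=
  k * (2 * dotp q h + 2 * dotp h h * t)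
    * expquad k (dotp q q) (dotp q h) (dotp h h) t
  - e * dotp (grad phi (x + t *: h)) h.

(** The exponential centered at [center x] lies above the barrier on the closure and agrees with it
    at [x]. The touching condition thus passes to the smooth function [line h]. *)
Let line_ge h y t : y = x + t *: h -> closure O y ->
  barrier x - e * phi x <= barrier y - e * phi y -> line h 0 <= line h t.
Proof.
move=> yE cly h1; have [cK _ _] := centerP clx.
rewrite /line -!expquad_line scale0r addr0 (le_trans h1)// yE lerB//.
by rewrite -yE; exact: barrier_le.
Qed.

Let is_derive_line1 h t : O (x + t *: h) -> is_derive t 1 (line h) (line1 h t).
Proof.
move=> Oy; have [phi_O _ _ _ _] := phiC2.
have [phi_diff _ _] := phi_O _ Oy.
apply: is_deriveB; first exact: is_derive_expquad.
apply: is_deriveZ; apply/is_derive_lineP; exact: is_derive_grad.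
Qed.

(** The right-hand matrix is the Hessian at [x] of the smooth majorant of the barrier; the
    inequality is the second-order condition for [line h] at its minimum, in every direction [h]. *)
Lemma barrier_touch_hessian : O x ->
  lemx (e *: H x)
    ((2 * k * barrier x)%:M + (4 * k ^+ 2 * barrier x) *: (q^T *m q)).
Proof.
move=> Ox h; have [phi_O GH _ _ _] := phiC2.
have [_ O_open _ _ _] := O_C2.
have [_ grad_diff _] := phi_O _ Ox.
have Oline : \forall t \near (0 : R), O (x + t *: h).
  by apply: near_line; exact: open_nbhs_nbhs.
have -> : H x = hessian phi x by have [] := GH x Ox.
have : 0 <= (2 * k * dotp h h + 4 * k ^+ 2 * dotp q h ^+ 2) * barrier x
    - e * dotp (h *m hessian phi x) h.
  have d1 : \forall t \near (0 : R), is_derive (t : R) 1 (line h) (line1 h t).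
    by near=> t; apply: is_derive_line1; near: t; exact: Oline.
  have d2 : is_derive (0 : R) 1 (line1 h)
      ((2 * k * dotp h h + 4 * k ^+ 2 * dotp q h ^+ 2) * expR (k * dotp q q)
      - e * dotp (h *m hessian phi x) h).
    apply: is_deriveB; first exact: is_derive_expquad1.
    apply: is_deriveZ.
    apply/(is_derive_lineP (fun u => dotp (grad phi u) h)).
    by rewrite scale0r addr0; exact: is_derive_dotp_grad.
  have d3 : \forall t \near (0 : R), line h 0 <= line h t.
    have tm : \forall t \near (0 : R), closure O (x + t *: h) ->
        barrier x - e * phi x <= barrier (x + t *: h) - e * phi (x + t *: h).
      exact: near_line touch.
    near=> t.
    have clt : closure O (x + t *: h).
      by apply: subset_closure; near: t; exact: Oline.
    by apply: (line_ge (erefl _) clt); move: clt; near: t; exact: tm.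
  exact: second_derive_ge0_at_min d1 d2 d3.
rewrite scalar_rank_one_form -scalemxAr dotpZl.
rewrite subr_ge0 => /le_trans; apply.
by rewrite le_eqVlt; apply/orP; left; apply/eqP; ring.
Unshelve. all: by end_near. Qed.

(** A boundary point is at distance exactly [r] from its center, so [q = r nu] and the inward normal
    enters the ball. If the inequality failed, the derivative of [line (- nu)] would have a negative
    limit at 0 from the right, and [line (- nu)] would fall below its minimum. *)
Lemma barrier_touch_normal : boundary O x ->
  alpha * barrier x <= e * dotp (G x) (outer_normal O x).
Proof.
move=> bx; have [phi_O GH phi_cont G_cont _] := phiC2.
have [_ O_open _ _ _] := O_C2.
have [cK qr _] := centerP clx.
have qq : dotp q q = r ^+ 2.
  apply/eqP; rewrite eq_le qr leNgt; apply/negP => /cK Ox.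
  by have [_] := bx; apply; exact: open_nbhs_nbhs.
have qE : q = r *: outer_normal O x.
  exact: (interior_ball_tangent O_C2 r_gt0 cK bx).
have nu1 := outer_normal_unit O_C2 bx.
set nu := outer_normal O x in qE nu1 *.
rewrite leNgt; apply/negP => normal_lt.
have Oline : \forall t \near (0 : R)^'+, O (x + t *: - nu).
  near=> t; apply: cK; rewrite /euclidean_ball /=.
  have t0 : 0 < t by near: t; exact: nbhs_right_gt.
  have tr : t < r by near: t; exact: nbhs_right_lt.
  have -> : x + t *: - nu - center x = (r - t) *: nu.
    by rewrite addrAC -/q qE scalerN scalerBl.
  rewrite dotpZl dotpZr nu1 mulr1 -expr2.
  by rewrite ltr_sqr ?nnegrE ?subr_ge0 ?ltW// ltrBlDr ltrDl.
(* At [x] only the continuous extensions of [phi] and its gradient are available, so values there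
   are reached as limits from inside. *)
have along (W : normedModType R) (f : 'rV[R]_n -> W) :
    {within closure O, continuous f} ->
    f (x + t *: - nu) @[t --> (0 : R)^'+] --> f x.
  move=> /subspace_continuousP/(_ x clx) fx; apply: cvg_comp fx => U.
  rewrite /within /= => xU.
  have : \forall t \near (0 : R),
      closure O (x + t *: - nu) -> U (x + t *: - nu).
    exact: near_line xU.
  move=> /near_at_right xU'; near=> t.
  have clt : closure O (x + t *: - nu) by apply: subset_closure; near: t.
  by move: clt; near: t; exact: xU'.
have q_nu : dotp q (- nu) = - r.
  by rewrite qE dotpNr dotpZl nu1 mulr1.
have nu_nu : dotp (- nu) (- nu) = 1 by rewrite dotpNl dotpNr opprK.
have cexp (t : R) : {for t, continuous (expquad k (dotp q q) (- r) 1)}.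
  apply: differentiable_continuous; apply/derivable1_diffP.
  by have [] := is_derive_expquad k (dotp q q) (- r) 1 t.
have d1 : \forall t \near (0 : R)^'+,
    is_derive (t : R) 1 (line (- nu)) (line1 (- nu) t).
  by apply: filterS Oline => t; exact: is_derive_line1.
have c1 : {for 0, continuous
    (fun t : R => k * (2 * - r + 2 * 1 * t) * expquad k (dotp q q) (- r) 1 t)}.
  apply: continuousM; last exact: cexp.
  apply: continuousM; first exact: cst_continuous.
  apply: continuousD; first exact: cst_continuous.
  by apply: continuousM; [exact: cst_continuous|exact: cvg_id].
have cG : {within closure O, continuous (fun y => dotp (G y) (- nu))}.
  move=> y; apply: (@continuous_comp (subspace (closure O)) _ _ G
    (fun u => dotp u (- nu)) y).
    exact: G_cont.
  exact: continuous_dotp.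
have line1_lim : k * (2 * - r + 2 * 1 * t) * expquad k (dotp q q) (- r) 1 t
    - e * dotp (G (x + t *: - nu)) (- nu) @[t --> (0 : R)^'+] -->
    k * (2 * - r + 2 * 1 * 0) * expquad k (dotp q q) (- r) 1 0
    - e * dotp (G x) (- nu).
  apply: cvgB; first exact: (cvg_at_right_filter c1).
  apply: cvgM; first exact: cvg_cst.
  exact: (along _ (fun y => dotp (G y) (- nu)) cG).
have lim_lt0 : k * (2 * - r + 2 * 1 * 0) * expquad k (dotp q q) (- r) 1 0
    - e * dotp (G x) (- nu) < 0.
  have -> : k * (2 * - r + 2 * 1 * 0) = - alpha.
    by rewrite /k; field; rewrite gt_eqF.
  rewrite /expquad expr0n /= !mulr0 !addr0 -/(barrier x) dotpNr.
  by rewrite mulrN opprK mulNr addrC subr_lt0.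
have d2 : \forall t \near (0 : R)^'+, line1 (- nu) t < 0.
  have lim_near := cvgr_lt _ line1_lim _ lim_lt0; near=> t.
  have Ot : O (x + t *: - nu) by near: t; exact: Oline.
  have [GE _] := GH _ Ot; rewrite /line1 q_nu nu_nu -GE.
  by near: t; exact: lim_near.
have d3 : line (- nu) t @[t --> (0 : R)^'+] --> line (- nu) 0.
  rewrite /line q_nu nu_nu scale0r addr0; apply: cvgB.
    by apply: cvg_at_right_filter; exact: cexp.
  by apply: cvgM; [exact: cvg_cst|exact: along].
have line_lt := decreasing_at_right0 d1 d2 d3.
have tm : \forall t \near (0 : R), closure O (x + t *: - nu) ->
    barrier x - e * phi x <= barrier (x + t *: - nu) - e * phi (x + t *: - nu).
  exact: near_line touch.
have : \forall t \near (0 : R)^'+, False.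
  have tm' := near_at_right tm.
  near=> t.
  have Ot : O (x + t *: - nu) by near: t.
  have clt := subset_closure Ot.
  have lt_t : line (- nu) t < line (- nu) 0 by near: t.
  have : line (- nu) 0 <= line (- nu) t.
    by apply: (line_ge (erefl _) clt); move: clt; near: t; exact: tm'.
  by rewrite leNgt lt_t.
by move=> /filter_ex[].
Unshelve. all: by end_near. Qed.

End touching.

End barrier.

(** * Eigenvalue bounds *)

Section lower_bounds.
Context {R : realType} {n : nat} (a A : R) (O : set 'rV[R]_n).
Hypotheses (O_C2 : bounded_C2_domain O) (a_gt0 : 0 < a) (aA : a <= A).
Variables (r alpha : R).
Hypotheses (r_gt0 : 0 < r) (alpha_gt0 : 0 < alpha).
Variable center : 'rV[R]_n -> 'rV[R]_n.
Hypothesis centerP : nearest_center O r center.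

Let w := barrier r alpha center.
Let k := alpha / (2 * r).
Let N x : 'M[R]_n := (2 * k * w x)%:M
  + (4 * k ^+ 2 * w x) *: ((x - center x)^T *m (x - center x)).

Let w_gt0 x : 0 < w x. Proof. exact: barrier_gt0. Qed.

Let k_gt0 : 0 < k. Proof. by rewrite divr_gt0// mulr_gt0. Qed.

Let N_psd x : psd (N x).
Proof.
apply: psd_scalar_rank_one.
  by apply: mulr_ge0; [apply: mulr_ge0 => //|]; exact: ltW.
apply: mulr_ge0; last exact: ltW.
by rewrite mulr_ge0// sqr_ge0.
Qed.

(** The trace of the majorant's Hessian is [(2 k n + 4 k^2 |x - c|^2) w]; then [|x - c| <= r] and
    [2 k r = alpha]. *)
Let N_trace x : closure O x ->
  \tr (N x) <= (alpha ^+ 2 + n%:R / r * alpha) * w x.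
Proof.
move=> /centerP[_ xr _]; rewrite mxtrace_scalar_rank_one.
have -> : (alpha ^+ 2 + n%:R / r * alpha) * w x =
    2 * k * w x * n%:R + 4 * k ^+ 2 * w x * r ^+ 2.
  by move: (w x) => u; rewrite /k; field; rewrite gt_eqF.
rewrite lerD2l ler_wpM2l//; apply: mulr_ge0; last exact: ltW.
by rewrite mulr_ge0// sqr_ge0.
Qed.

Lemma barrier_supersolution :
  viscosity_supersolution a A O alpha
    (- (A * (alpha ^+ 2 + n%:R / r * alpha))) w.
Proof.
split; first exact: barrier_lsc.
move=> phi G H phiC2 x clx touch.
have touch1 : local_min_on (closure O) (fun y => w y - 1 * phi y) x.
  by apply: filterS touch => y; rewrite !mul1r.
split=> [Ox|bx].
  have := barrier_touch_hessian
    O_C2 r_gt0 alpha_gt0 centerP phiC2 clx touch1 Ox.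
  rewrite scale1r => /(pucci_le_psd a_gt0 aA (N_psd x)) HN.
  have A_ge0 : 0 <= A by rewrite (le_trans _ aA)// ltW.
  have := ler_wpM2l A_ge0 (N_trace clx); lra.
have := barrier_touch_normal O_C2 r_gt0 alpha_gt0 centerP phiC2 clx touch1 bx.
by rewrite mul1r le_max subr_ge0 => ->; rewrite orbT.
Qed.

Lemma barrier_subsolution :
  viscosity_subsolution a A O alpha
    (- (a * (alpha ^+ 2 + n%:R / r * alpha))) (\- w).
Proof.
split.
  rewrite /usc_on (_ : (fun x => _) = w); last first.
    by apply/funext => x; rewrite /= opprK.
  exact: barrier_lsc.
move=> phi G H phiC2 x clx touch.
have touch1 : local_min_on (closure O) (fun y => w y - -1 * phi y) x.
  by apply: filterS touch => y /=; rewrite !mulN1r !opprK; lra.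
split=> [Ox|bx].
  have HN := barrier_touch_hessian
    O_C2 r_gt0 alpha_gt0 centerP phiC2 clx touch1 Ox.
  have NH : lemx (- N x) (H x).
    move=> y; have := HN y; rewrite scaleN1r !mulmxN !dotpNl.
    by rewrite lerNl.
  have aaA : a <= a <= A by rewrite lexx.
  have := pucci_ge_scalar a_gt0 aA aaA NH.
  rewrite raddfN/=.
  have := ler_wpM2l (ltW a_gt0) (N_trace clx); lra.
have := barrier_touch_normal O_C2 r_gt0 alpha_gt0 centerP phiC2 clx touch1 bx.
rewrite ge_min => h; apply/orP; right.
by move: h; rewrite -/w /=; lra.
Qed.

End lower_bounds.

Lemma le_oppr_sqr_limit (R : realType) (B alpha lambda : R) :
  0 < B -> 0 < alpha ->
  (forall b, 0 < b < alpha -> lambda <= - (B * b ^+ 2)) ->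
  lambda <= - (B * alpha ^+ 2).
Proof.
move=> B_gt0 alpha_gt0 H; rewrite leNgt; apply/negP => gap.
(* With [b = alpha - d], the first entry keeps [b] positive and the second makes the loss
   [2 B alpha d] at most half of the assumed gap. *)
pose d := Num.min (alpha / 2) ((lambda + B * alpha ^+ 2) / (4 * B * alpha)).
have den_gt0 : 0 < 4 * B * alpha by rewrite !mulr_gt0.
have d_gt0 : 0 < d.
  by rewrite lt_min !divr_gt0//; lra.
have d1 : d <= alpha / 2 by rewrite ge_min lexx.
have d2 : d * (4 * B * alpha) <= lambda + B * alpha ^+ 2.
  by rewrite -ler_pdivlMr// ge_min lexx orbT.
have : lambda <= - (B * (alpha - d) ^+ 2) by apply: H; apply/andP; split; lra.
have : 0 <= B * d ^+ 2 by rewrite mulr_ge0 ?sqr_ge0// ltW.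
have -> : B * (alpha - d) ^+ 2 =
    B * alpha ^+ 2 - d * (4 * B * alpha) / 2 + B * d ^+ 2.
  by field.
by lra.
Qed.

Section eigenvalue_bounds.
Context {R : realType} {n : nat} (a A : R) (O : set 'rV[R]_n).
Hypotheses (O_C2 : bounded_C2_domain O) (a_gt0 : 0 < a) (aA : a <= A).

Lemma lambda_plus_le alpha : (0 < n)%N -> 0 < alpha ->
  (lambda_plus a A O alpha <= (- (A * alpha ^+ 2))%:E)%E.
Proof.
move=> n_gt0 alpha_gt0.
apply: ge_ereal_sup => _ [lambda [v [v_gt0 _ v_super]] <-]; rewrite lee_fin.
apply: le_oppr_sqr_limit => //; first exact: lt_le_trans aA.
by move=> b bP; apply: (supersolution_upper_bound (Ordinal n_gt0)) v_super.
Qed.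

Lemma lambda_minus_le alpha : (0 < n)%N -> 0 < alpha ->
  (lambda_minus a A O alpha <= (- (a * alpha ^+ 2))%:E)%E.
Proof.
move=> n_gt0 alpha_gt0.
apply: ge_ereal_sup => _ [lambda [v [v_lt0 _ v_sub]] <-]; rewrite lee_fin.
apply: le_oppr_sqr_limit => //.
by move=> b bP; apply: (subsolution_upper_bound (Ordinal n_gt0)) v_sub.
Qed.

Lemma exists_nearest_center : exists2 r, 0 < r &
  exists center : 'rV[R]_n -> 'rV[R]_n, nearest_center O r center.
Proof.
have [r r_gt0 int_ball] := uniform_interior_ball O_C2; exists r => //.
have /choice[center centerP] (x : 'rV[R]_n) :
    exists c, closure O x -> nearest_center_at O r x c.
  have [clx|nclx] := pselect (closure O x); last by exists 0.
  by have [c cP] := nearest_ball_center O_C2 r_gt0 (int_ball x clx); exists c.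
by exists center.
Qed.

(** The radius [r] depends on the domain alone, so [C = n / r] serves every [alpha]. *)
Lemma lambda_lower_bounds : exists C : R, forall alpha, 0 < alpha ->
  ((- (A * (alpha ^+ 2 + C * alpha)))%:E <= lambda_plus a A O alpha)%E /\
  ((- (a * (alpha ^+ 2 + C * alpha)))%:E <= lambda_minus a A O alpha)%E.
Proof.
have [r r_gt0 [center centerP]] := exists_nearest_center.
exists (n%:R / r) => alpha alpha_gt0; split; apply: ereal_sup_ubound => /=.
- exists (- (A * (alpha ^+ 2 + n%:R / r * alpha))) => //.
  exists (barrier r alpha center); split.
  + by move=> x _; exact: barrier_gt0.
  + have := barrier_bounded r_gt0 alpha_gt0 centerP (e := 1).
    by rewrite normr1 lexx => /(_ isT); under eq_fun do rewrite mul1r.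
  + exact: barrier_supersolution.
- exists (- (a * (alpha ^+ 2 + n%:R / r * alpha))) => //.
  exists (\- barrier r alpha center); split.
  + by move=> x _; rewrite /= oppr_lt0; exact: barrier_gt0.
  + have := barrier_bounded r_gt0 alpha_gt0 centerP (e := -1).
    by rewrite normrN1 lexx => /(_ isT); under eq_fun do rewrite mulN1r.
  + exact: barrier_subsolution.
Qed.

End eigenvalue_bounds.

(** Division by [- alpha^2] reverses the inequalities and squeezes the quotient between [B] and
    [B + B C / alpha]. *)
Lemma quotient_sqr_cvg (R : realType) (L : R -> \bar R) (B C : R) :
  (forall alpha, 0 < alpha ->
    ((- (B * (alpha ^+ 2 + C * alpha)))%:E <= L alpha)%E /\
    (L alpha <= (- (B * alpha ^+ 2))%:E)%E) ->
  (L alpha / (- alpha ^+ 2)%:E)%E @[alpha --> +oo] --> B%:E.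
Proof.
move=> LB.
apply: (@squeeze_cvge _ _ _ _ (cst B%:E) _
  (fun alpha => (B + B * C * alpha^-1)%:E)).
- near=> alpha.
  have alpha_gt0 : 0 < alpha by near: alpha; exact: nbhs_pinfty_gt.
  have [lo hi] := LB alpha alpha_gt0.
  (* Both bounds are real, so [L alpha] is finite and the division takes place in [R]. *)
  move: lo hi; case: (L alpha) => [l||] //; rewrite !lee_fin => lo hi.
  have sqr_gt0 : 0 < alpha ^+ 2 by rewrite exprn_gt0.
  rewrite inver oppr_eq0 gt_eqF// -EFinM !lee_fin.
  rewrite invrN mulrN -mulNr ler_pdivlMr// ler_pdivrMr//.
  have -> : (B + B * C * alpha^-1) * alpha ^+ 2 = B * (alpha ^+ 2 + C * alpha).
    by field; rewrite gt_eqF.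
  by apply/andP; split; lra.
- exact: cvg_cst.
- apply: cvg_EFin; first by near=> alpha.
  have inv0 : (alpha : R)^-1 @[alpha --> +oo] --> 0.
    apply/gtr0_cvgV0; last exact: cvg_id.
    exact: nbhs_pinfty_gt.
  rewrite -[X in _ --> X]addr0 -[X in _ --> _ + X](mulr0 (B * C)).
  exact: (cvgD (cvg_cst B) (cvgM (cvg_cst (B * C)) inv0)).
Unshelve. all: by end_near. Qed.

Theorem theorem1p1 (R : realType) (n : nat) (n_gt0 : (0 < n)%N)
    (Omega : set 'rV[R]_n) (a A : R) :
  bounded_C2_domain Omega -> 0 < a -> a <= A ->
  (lambda_plus a A Omega alpha / (- alpha ^+ 2)%:E)%E
    @[alpha --> +oo] --> A%:E /\
  (lambda_minus a A Omega alpha / (- alpha ^+ 2)%:E)%E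
    @[alpha --> +oo] --> a%:E.
Proof.
move=> O_C2 a_gt0 aA.
have [C HC] := lambda_lower_bounds O_C2 a_gt0 aA.
split; apply: (quotient_sqr_cvg (C := C)) => alpha alpha_gt0;
  have [lo_plus lo_minus] := HC alpha alpha_gt0; split=> //.
- exact: lambda_plus_le.
- exact: lambda_minus_le.
Qed.
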